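(* Let $G$ be a finite graph with distinct cospectral vertices $u,v\in V(G)$, let $k\ge3$ be any odd integer, and let $\mathbb{P}_k$ be the path on $k$ nodes, with its endpoints called $u,v$. Let $A_G$ and $A_{\mathbb{P}_k}$ be the adjacency matrices of $G$ and $\mathbb{P}_k$. Then a potential $c\in\mathbb{R}$ can be chosen, to be added at every vertex of $\mathbb{P}_k$, such that the adjacency matrix of $G\setminus\{u,v\}$ and the matrix $A_{\mathbb{P}_k\setminus\{u,v\}}+cI$ share no eigenvalues, and such that the following holds: if $G'$ is created by gluing the path with this potential to $G$ at the nodes $u$ and $v$, then putting a transcendental potential $Q\in\mathbb{R}$ on $u$ and $v$ induces PGST from $u$ to $v$ in $G'$; i.e. for every transcendental $Q\in\mathbb{R}$ the matrix $$N=\bigl(A_G\oplus(A_{\mathbb{P}_k}+cI)\bigr)+Q\cdot D_{uv}$$ has PGST from $u$ to $v$.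
   Context: Vertices $u,v$ of $G$ are cospectral if the adjacency matrices of $G\setminus u$ and $G\setminus v$ have the same characteristic polynomial. The vertex sets of $G$ and $\mathbb{P}_k$ are taken to intersect exactly in $\{u,v\}$. For symmetric matrices $M_1,M_2$ with index sets satisfying $V(M_1)\cap V(M_2)=\{u,v\}$, $M_1\oplus M_2$ is the matrix indexed by $V(M_1)\cup V(M_2)$ obtained by extending each $M_i$ by zeros to $V(M_1)\cup V(M_2)$ and adding the two extensions (gluing). $D_{uv}$ is the diagonal matrix with 1 in positions $u,v$ and 0 elsewhere. A real symmetric matrix $N$ has PGST (pretty good state transfer) from $u$ to $v$ if $\limsup_{t\to\infty}|(e^{itN})(u,v)|=1$. *)

(* Defs.v *)
From HB Require Import structures.
From mathcomp Require Import all_boot all_order all_algebra.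
From mathcomp Require Import all_classical all_reals all_analysis.
From mathcomp Require Import complex.

Set Implicit Arguments.
Unset Strict Implicit.
Unset Printing Implicit Defensive.

Import Order.TTheory GRing.Theory Num.Theory.
Import numFieldNormedType.Exports.

Local Open Scope ring_scope.

Record sgraph := SGraph {
  vertex :> finType;
  edge : rel vertex;
  edge_sym : symmetric edge;
  edge_irr : irreflexive edge }.

(* A matrix with index set a finite type V is a 'M_#|V|, whose rows and columns
   are numbered by enum_rank : V -> 'I_#|V| (with inverse enum_val). *)
Definition fmx (R : Type) (V : finType) (F : V -> V -> R) : 'M[R]_#|V| :=
  \matrix_(i, j) F (enum_val i) (enum_val j).

Definition entry (R : Type) (V : finType) (M : 'M[R]_#|V|) (x y : V) : R :=
  M (enum_rank x) (enum_rank y).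

Definition adjmx (R : pzRingType) (G : sgraph) : 'M[R]_#|G| :=
  fmx (fun x y : G => (edge x y)%:R).

Section Deletion.
Variables (G : sgraph) (S : {set G}).

Definition del_edge : rel {x : G | x \notin S} :=
  fun x y => edge (val x) (val y).

Lemma del_edge_sym : symmetric del_edge.
Proof. by move=> x y; apply: edge_sym. Qed.

Lemma del_edge_irr : irreflexive del_edge.
Proof. by move=> x; apply: edge_irr. Qed.

Definition del : sgraph := SGraph del_edge_sym del_edge_irr.
End Deletion.

Section Path.
Variable k : nat.

Definition path_edge : rel 'I_k :=
  fun i j => (i.+1 == j :> nat) || (j.+1 == i :> nat).

Lemma path_edge_sym : symmetric path_edge.
Proof. by move=> i j; rewrite /path_edge orbC. Qed.

Lemma path_edge_irr : irreflexive path_edge.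
Proof. by move=> i; rewrite /path_edge orbb gtn_eqF. Qed.

Definition path_graph : sgraph := SGraph path_edge_sym path_edge_irr.
End Path.

Definition cospectral (R : comNzRingType) (G : sgraph) (u v : G) : Prop :=
  char_poly (adjmx R (del [set u])) = char_poly (adjmx R (del [set v])).

(* Extension by zeros of a matrix indexed by V to a matrix indexed by W, where
   V is seen inside W through a partial inverse f : W -> option V of the
   embedding of V in W. *)
Definition extend0 (R : nmodType) (V W : finType) (f : W -> option V)
    (M : 'M[R]_#|V|) : 'M[R]_#|W| :=
  fmx (fun x y => match f x, f y with
                  | Some a, Some b => entry M a b
                  | _, _ => 0
                  end).

(* The union of V1 and V2 in which u2 is identified with u1 and v2 with v1, so
   that V1 and V2 meet exactly in {u1, v1}. *)
Section Gluing.
Variables (V1 V2 : finType) (u1 v1 : V1) (u2 v2 : V2).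

Definition glue_type : finType := (V1 + {y : V2 | y \notin [set u2; v2]})%type.

Definition glue_fst (x : glue_type) : option V1 :=
  match x with inl a => Some a | inr _ => None end.

Definition glue_snd (x : glue_type) : option V2 :=
  match x with
  | inl a => if a == u1 then Some u2 else if a == v1 then Some v2 else None
  | inr b => Some (val b)
  end.

Definition mxglue (R : nmodType) (M1 : 'M[R]_#|V1|) (M2 : 'M[R]_#|V2|) :
    'M[R]_#|glue_type| :=
  extend0 glue_fst M1 + extend0 glue_snd M2.
End Gluing.

Definition Dmx (R : pzRingType) (V : finType) (u v : V) : 'M[R]_#|V| :=
  fmx (fun x y => ((x == y) && (x \in [set u; v]))%:R).

Definition expmx (K : numFieldType) (n : nat) (A : 'M[K]_n) : 'M[K]_n :=
  limn (series (fun m => (m`!%:R)^-1 *: A ^+ m)).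

(* |(e^{itN})(u,v)| *)
Definition transfer (R : realType) (V : finType) (N : 'M[R]_#|V|) (u v : V)
    (t : R) : R :=
  ComplexField.Normc.normc
    (entry (expmx (('i * t%:C)%C *: map_mx (real_complex R) N)) u v).

Definition PGST (R : realType) (V : finType) (N : 'M[R]_#|V|) (u v : V) :
    Prop :=
  limf_esup (fun t : R => (transfer N u v t)%:E) (pinfty_nbhs R) = 1%:E.

Definition transcendental (R : realType) (x : R) : Prop :=
  ~ algebraicOver (ratr : rat -> R) x.

(* Main.v *)
(* For eps = 1, -1 put b = e_u + eps e_v, and let H be the glued matrix without
   Q. Cospectrality of u and v in G, and the reflection of the path, provide a
   polynomial vector w over the rationals with w = B b on {u, v} and (x - H) w =
   A b, where A and B are coprime; hence (x - H - Q D) w = (A - Q B) b, so every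
   eigenvalue of N having an eigenvector that is not orthogonal to b is a root of
   A - Q B, an irreducible polynomial over the field of rational functions of Q
   since Q is transcendental. All the eigenvalues of one sign have therefore the
   same normalized trace over that field, namely (Q - a) / deg A with a the
   subleading coefficient of A. As k is odd, c occurs with different
   multiplicities in the two values of a, so that for a suitable c the two
   normalized traces differ, and an integer relation sum l_i theta_i = 0 with sum
   l_i = 0 between the eigenvalues satisfies sum l_i = 0 already over the
   eigenvalues of negative sign. On the other hand 4 (exp(itN))(u,v) is the sum
   of |<phi, e_u + e_v>|^2 exp(it theta) minus the sum of |<phi, e_u - e_v>|^2
   exp(it theta) over an orthonormal eigenbasis, of total weight 4; Kronecker's
   theorem, in the form given by Bohr's proof, applies to this sum by the absence
   of obstructing relations. *)
From HB Require Import structures.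
From mathcomp Require Import all_boot all_order all_algebra.
From mathcomp Require Import ring lra zify.
From mathcomp Require Import all_classical all_reals all_analysis.
From mathcomp Require Import complex.
From mathcomp Require Import perm spectral separable.
Require Import Defs.

Set Implicit Arguments.
Unset Strict Implicit.
Unset Printing Implicit Defensive.

Import Order.TTheory GRing.Theory Num.Theory.
Import numFieldNormedType.Exports.

Local Open Scope ring_scope.

(** * Subleading coefficients and normalized traces *)

Section SubleadingCoefficient.
Variable R : nzRingType.
Implicit Types p q : {poly R}.

Lemma monic_size1 p : p \is monic -> size p = 1 -> p = 1.
Proof.
move=> mp sp; rewrite [p]size1_polyC ?sp //.
by have := monicP mp; rewrite lead_coefE sp => ->.
Qed.

Lemma monic_split p n : p \is monic -> size p = n.+2 ->
  exists2 s : {poly R}, p = 'X^(n.+1) + s & (size s <= n.+1)%N.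
Proof.
move=> /monicP lp sp; exists (p - 'X^(n.+1)); first by rewrite addrC subrK.
apply/leq_sizeP => j; rewrite leq_eqVlt coefB coefXn => /orP[/eqP <-|ltj].
  by rewrite eqxx -lp lead_coefE sp subrr.
by rewrite nth_default ?sp // gtn_eqF // subr0.
Qed.

(* The factor 'X makes the subleading coefficient of a constant equal to 0. *)
Definition subcoef p : R := ('X * p)`_(size p).-1.

Lemma subcoefE p n : size p = n.+2 -> subcoef p = p`_n.
Proof. by move=> sp; rewrite /subcoef sp coefXM. Qed.

Lemma subcoef1 : subcoef 1 = 0.
Proof. by rewrite /subcoef size_poly1 coefXM. Qed.

(** Over a field, [subcoef] of a monic polynomial is minus the sum of its roots, hence additive. In
    the product below only ['X^(m.+1) * t] and [s * 'X^(n.+1)] reach the degree just under the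
    top. *)
Lemma subcoefM p q : p \is monic -> q \is monic ->
  subcoef (p * q) = subcoef p + subcoef q.
Proof.
move=> mp mq.
case sp: (size p) => [|[|m]].
- by have := monic_neq0 mp; rewrite -size_poly_eq0 sp.
- by rewrite (monic_size1 mp sp) mul1r subcoef1 add0r.
case sq: (size q) => [|[|n]].
- by have := monic_neq0 mq; rewrite -size_poly_eq0 sq.
- by rewrite (monic_size1 mq sq) mulr1 subcoef1 addr0.
have spq : size (p * q) = (m + n).+3.
  by rewrite size_Mmonic // ?sp ?sq //= ?addnS ?addSn // -size_poly_eq0 sp.
have [s ps ss] := monic_split mp sp; have [t qt st] := monic_split mq sq.
rewrite (subcoefE spq) (subcoefE sp) (subcoefE sq).
have -> : p * q = 'X^((m + n).+2) + 'X^(m.+1) * t + s * 'X^(n.+1) + s * t.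
  by rewrite ps qt mulrDl !mulrDr -exprD addnS addSn addrA.
have pm : p`_m = s`_m by rewrite ps coefD coefXn ltn_eqF // add0r.
have qn : q`_n = t`_n by rewrite qt coefD coefXn ltn_eqF // add0r.
rewrite pm qn !coefD coefXn ltn_eqF ?ltnS // coefXnM coefMXn.
rewrite !ltnS !subSS.
case: ltnP => [lt|_]; first lia.
case: ltnP => [lt|_]; first lia.
rewrite [(s * t)`__]nth_default; first by rewrite addr0 addnK addKn add0r addrC.
apply: leq_trans (size_polyMleq _ _) _.
by move: ss st; set a := size s; set b := size t; lia.
Qed.

Lemma subcoefX p n : p \is monic -> subcoef (p ^+ n) = subcoef p *+ n.
Proof.
move=> mp; elim: n => [|n IHn]; first by rewrite expr0 subcoef1.
by rewrite exprS subcoefM ?monic_exp // IHn mulrS.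
Qed.
End SubleadingCoefficient.

(** * Minimal polynomials and the mean of the conjugates of an algebraic element *)

Section NormalizedTrace.
Variables (F : fieldType) (K : closedFieldType) (iota : {rmorphism F -> K}).
Hypothesis charF0 : [pchar F] =i pred0.
Local Notation "p ^@" := (map_poly iota p) (at level 2, format "p ^@").

Definition minpoly_of (P : {poly F}) (x : K) : Prop :=
  [/\ P \is monic, root P^@ x &
      forall g : {poly F}, root g^@ x -> P %| g].

Lemma minpoly_ex x : algebraicOver iota x -> exists P, minpoly_of P x.
Proof.
case=> p p0 px.
pose ann m := `[< exists2 g : {poly F}, g != 0 & root g^@ x /\ size g = m >].
have exann : exists m, ann m by exists (size p); apply/asboolP; exists p.
case: (ex_minnP exann) => m /asboolP[g g0 [gx sg]] minm.
pose P := (lead_coef g)^-1 *: g.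
have lg0 : (lead_coef g)^-1 != 0 by rewrite invr_eq0 lead_coef_eq0.
have Px : root P^@ x by rewrite map_polyZ rootZ // fmorph_eq0.
have sP : size P = m by rewrite size_scale.
exists P; split=> //.
  by rewrite monicE lead_coefZ mulVf // lead_coef_eq0.
move=> h hx; rewrite /dvdp -[_ == _]negbK; apply/negP => r0.
have P0 : P != 0 by rewrite scaler_eq0 (negPf lg0).
have : ann (size (h %% P)).
  apply/asboolP; exists (h %% P) => //; split => //.
  move: hx; rewrite {1}(divp_eq h P) rmorphD rmorphM /=.
  by rewrite /root !hornerE (rootP Px) mulr0 add0r.
move/minm; rewrite -sP leqNgt => /negP; apply.
by rewrite ltn_modp.
Qed.

(** [P] is irreducible over [F], so a nonconstant [g] sharing a root with it is divisible by it;
    divide and induct on the size. *)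
Lemma minpoly_root_pow P x (g : {poly F}) : minpoly_of P x -> g \is monic ->
  (forall z, root g^@ z -> root P^@ z) -> exists e, g = P ^+ e.
Proof.
case=> mP Px minP; have [n] := ubnP (size g).
elim: n g => // n IHn g; rewrite ltnS => sgn mg gP.
have [sg1|sg1] := eqVneq (size g) 1.
  by exists 0; rewrite expr0 (monic_size1 mg sg1).
have [z gz] : exists z, root g^@ z by apply/closed_rootP; rewrite size_map_poly.
have Pz := gP _ gz.
have Pg : P %| g.
  have /dvdpP[q Pq] := dvdp_gcdl P g.
  have : root q^@ x || root (gcdp P g)^@ x.
    by rewrite -rootM -rmorphM /= -Pq.
  case/orP => [/minP Pdq | /minP /dvdp_trans->//]; last exact: dvdp_gcdr.
  (* In the remaining case [P] divides the cofactor [q], so the gcd is constant, against the common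
     root [z]. *)
  have P0 := monic_neq0 mP.
  have : size (gcdp P g) = 1.
    have q0 : q != 0 by apply: contraNneq P0 => q0; rewrite Pq q0 mul0r.
    have g0 : gcdp P g != 0 by apply: contraNneq P0 => g0; rewrite Pq g0 mulr0.
    have := dvdp_leq q0 Pdq; rewrite {1}Pq size_mul //.
    have := size_poly_gt0 q; have := size_poly_gt0 (gcdp P g).
    rewrite q0 g0; set a := size q; set b := size (gcdp _ _); lia.
  move=> sg; have cop : coprimep P^@ g^@ by rewrite coprimep_map /coprimep sg.
  by have := coprimep_root cop Pz; rewrite (rootP gz) eqxx.
case/dvdpP: Pg => q gqP; have mq : q \is monic by rewrite gqP monicMr in mg.
have [||e qe] := IHn q _ mq.
- have sP : (1 < size P)%N.
    by rewrite -(size_map_poly iota) (root_size_gt1 _ Pz) // map_poly_eq0 monic_neq0.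
  have q0 := monic_neq0 mq.
  apply: leq_trans sgn; rewrite gqP size_Mmonic //.
  have := size_poly_gt0 q; rewrite q0; lia.
- by move=> y qy; apply: gP; rewrite gqP rmorphM /= rootM qy.
by exists e.+1; rewrite exprSr -qe.
Qed.

(** Every root of the characteristic polynomial is an eigenvalue, hence a root of [P]; so that
    polynomial is some [P ^+ e], and [subcoef] gets multiplied by [e]. *)
Lemma mxtrace_pow_minpoly n (M : 'M[F]_n.+1) P x : minpoly_of P x ->
  horner_mx M P = 0 -> \tr M *+ (size P).-1 = - subcoef P *+ n.+1.
Proof.
move=> minP MP; have [mP Px _] := minP.
have [z|e De] := minpoly_root_pow minP (char_poly_monic M).
  rewrite map_char_poly -root_mxminpoly; apply: root_dvdp => //.
  by rewrite mxminpoly_map dvdp_map mxminpoly_min.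
have sP : (1 < size P)%N.
  by rewrite -(size_map_poly iota) (root_size_gt1 _ Px) // map_poly_eq0 monic_neq0.
have := size_exp P e; rewrite -De size_char_poly /= => Dn.
have := char_poly_trace M (ltn0Sn n); rewrite -(subcoefE (size_char_poly M)).
rewrite De subcoefX // => /(congr1 -%R); rewrite opprK => <-.
by rewrite -mulNrn -mulrnA mulnC -Dn.
Qed.

Lemma horner_mx_comp n (A : 'M[F]_n.+1) (P f : {poly F}) :
  horner_mx A (P \Po f) = horner_mx (horner_mx A f) P.
Proof.
elim/poly_ind: P => [|P c IHP]; first by rewrite comp_poly0 !rmorph0.
rewrite comp_polyD comp_polyM comp_polyX comp_polyC !rmorphD !rmorphM /= IHP.
by rewrite horner_mx_X !horner_mx_C.
Qed.

(** The mean of the conjugates of [x] over [F], written without division. It refers to no finite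
    extension containing [x], so elements of different degrees can be compared. *)
Definition ntrace (x : K) (t : F) : Prop :=
  exists2 P, minpoly_of P x & t *+ (size P).-1 = - subcoef P.

Lemma minpoly_size P x : minpoly_of P x -> (1 < size P)%N.
Proof.
case=> mP Px _; rewrite -(size_map_poly iota) (root_size_gt1 _ Px) //.
by rewrite map_poly_eq0 monic_neq0.
Qed.

Lemma minpoly_algebraic P x : minpoly_of P x -> algebraicOver iota x.
Proof. by case=> mP Px _; exists P => //; apply: monic_neq0. Qed.

Lemma mulrnI_char0 n (a b : F) : (0 < n)%N -> a *+ n = b *+ n -> a = b.
Proof.
move=> n0 /eqP; rewrite -subr_eq0 -mulrnBl -mulr_natr mulf_eq0.
by rewrite ((pcharf0P F).1 charF0) (gtn_eqF n0) orbF subr_eq0 => /eqP.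
Qed.

Lemma ntrace_ex x : algebraicOver iota x -> exists t, ntrace x t.
Proof.
case/minpoly_ex => P minP; have sP := minpoly_size minP.
have d0 : (size P).-1%:R != 0 :> F.
  by rewrite ((pcharf0P F).1 charF0) -lt0n -subn1 subn_gt0.
exists (- subcoef P / (size P).-1%:R); exists P => //.
by rewrite -[_ *+ _]mulr_natr mulfVK.
Qed.

Lemma minpoly_uniq P P' x : minpoly_of P x -> minpoly_of P' x -> P = P'.
Proof.
case=> mP Px minP [mP' Px' minP']; apply/eqP.
by rewrite -eqp_monic // /eqp minP // minP'.
Qed.

Lemma ntrace_uniq x t t' : ntrace x t -> ntrace x t' -> t = t'.
Proof.
case=> P minP Dt [P' minP' Dt']; rewrite -(minpoly_uniq minP minP') in Dt'.
apply: (@mulrnI_char0 (size P).-1); last by rewrite Dt Dt'.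
by have := minpoly_size minP; case: (size P) => [|[]].
Qed.

Lemma ntrace_algebraic x t : ntrace x t -> algebraicOver iota x.
Proof. by case=> P /minpoly_algebraic. Qed.

Lemma ntrace0 : ntrace 0 0.
Proof.
exists 'X; last by rewrite mul0rn (@subcoefE _ _ 0) ?size_polyX // coefX oppr0.
split; first exact: monicX.
  by rewrite map_polyX /root hornerX.
move=> g; rewrite /root -[X in _.[X]](rmorph0 iota) horner_map fmorph_eq0.
by rewrite -[_ == 0]/(root g 0) -dvdp_XsubCl subr0.
Qed.

(* If z has degree n over F then f(z) acts on F(z) as the polynomial f in the
   companion matrix of the minimal polynomial of z, so that every element of
   F(z) has normalized trace 1/n times the trace of a matrix. *)
Lemma ntrace_companion z : algebraicOver iota z ->
  exists n, exists A : 'M[F]_n.+1, forall (f : {poly F}) t,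
    ntrace f^@.[z] t -> \tr (horner_mx A f) = t *+ n.+1.
Proof.
case/minpoly_ex => p minp; have sp := minpoly_size minp.
have [mp pz p_min] := minp.
have [n [A chA]] : exists n, exists A : 'M[F]_n.+1, char_poly A = p.
  have := companionmxK mp; move: (companionmx p).
  case: (size p) sp => [|[|n]] // _ A chA.
  by exists n, A.
exists n, A => f t [P minP Dt]; have [mP Pfz P_min] := minP.
apply: (@mulrnI_char0 (size P).-1).
  by have := minpoly_size minP; case: (size P) => [|[]].
rewrite (mxtrace_pow_minpoly minP); first by rewrite -Dt mulrnAC.
rewrite -horner_mx_comp; have /p_min/dvdpP[q ->] : root (P \Po f)^@ z.
  by rewrite map_comp_poly /root horner_comp.
by rewrite rmorphM /= -chA Cayley_Hamilton mulr0.
Qed.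

Lemma ntraceZ (c : F) x t : ntrace x t -> ntrace (iota c * x) (c * t).
Proof.
move=> xt; have algx := ntrace_algebraic xt.
have [t' cxt'] : exists t', ntrace (iota c * x) t'.
  by apply: ntrace_ex; apply: algebraic_mul => //; apply: algebraic_id.
have [n [A trA]] := ntrace_companion algx.
have /trA tr1 : ntrace ('X : {poly F})^@.[x] t by rewrite map_polyX hornerX.
have /trA tr2 : ntrace (c *: 'X : {poly F})^@.[x] t'.
  by rewrite map_polyZ map_polyX hornerZ hornerX.
rewrite linearZ /= mxtraceZ tr1 mulrnAr in tr2.
by rewrite (mulrnI_char0 (ltn0Sn n) tr2).
Qed.

(** A primitive element of [F(x, y)] makes [x], [y] and [x + y] polynomials in one element; its
    companion matrix reduces the claim to additivity of the matrix trace. *)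
Lemma ntraceD x y t u : ntrace x t -> ntrace y u -> ntrace (x + y) (t + u).
Proof.
move=> xt yu; have algx := ntrace_algebraic xt; have algy := ntrace_algebraic yu.
have [v xyv] := ntrace_ex (algebraic_add algx algy).
have [p p0 px] := algx; have [q q0 qy] := algy.
have [n [[f fz] [g gz]]] := pchar0_PET p0 px q0 qy charF0.
have algz : algebraicOver iota (y *+ n - x).
  apply: algebraic_sub => //; rewrite -mulr_natr; apply: algebraic_mul => //.
  by rewrite -(rmorph_nat iota); apply: algebraic_id.
have [m [A trA]] := ntrace_companion algz.
have /trA tr1 : ntrace f^@.[y *+ n - x] t by rewrite fz.
have /trA tr2 : ntrace g^@.[y *+ n - x] u by rewrite gz.
have /trA tr3 : ntrace (f + g)^@.[y *+ n - x] v.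
  by rewrite rmorphD hornerD fz gz.
rewrite rmorphD mxtraceD tr1 tr2 -mulrnDl in tr3.
by rewrite (mulrnI_char0 (ltn0Sn m) tr3).
Qed.

Lemma ntrace_sum (I : finType) (l : I -> int) (x : I -> K) (t : I -> F) :
  (forall i, l i != 0 -> ntrace (x i) (t i)) ->
  ntrace (\sum_i (l i)%:~R * x i) (\sum_i (l i)%:~R * t i).
Proof.
move=> xt; apply: (big_ind2 ntrace) => [||i _]; first exact: ntrace0.
  by move=> *; apply: ntraceD.
have [->|li] := eqVneq (l i) 0; first by rewrite !mul0r; apply: ntrace0.
by rewrite -(rmorph_int iota); apply/ntraceZ/xt.
Qed.
End NormalizedTrace.

(** * The field of rational functions of a transcendental number *)

Section RationalFunctionsAt.
Variables (K : numClosedFieldType) (q : K).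
Local Notation "p ^@" := (map_poly (ratr : rat -> K) p) (at level 2, format "p ^@").

(** The subfield of [K] generated by [q]; realizing rational functions inside [K] makes [val] the
    embedding over which minimal polynomials are taken. *)
Definition ratfun_pred : {pred K} :=
  fun x => `[< exists f g : {poly rat}, g^@.[q] != 0 /\ x = f^@.[q] / g^@.[q] >].

Lemma ratfun_predP x : reflect
  (exists f g : {poly rat}, g^@.[q] != 0 /\ x = f^@.[q] / g^@.[q])
  (x \in ratfun_pred).
Proof. exact: asboolP. Qed.

Lemma ratfun_divring_closed : divring_closed ratfun_pred.
Proof.
split=> [|x y|x y].
- apply/ratfun_predP; exists 1, 1.
  by rewrite !rmorph1 -polyC1 !hornerC divr1 oner_neq0.
- case/ratfun_predP=> f [g [g0 ->]] /ratfun_predP[f' [g' [g'0 ->]]].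
  apply/ratfun_predP; exists (f * g' - f' * g), (g * g').
  rewrite rmorphB !rmorphM /= !hornerE mulf_neq0 //; split=> //.
  by rewrite -mulNr addf_div // mulNr.
- case/ratfun_predP=> f [g [g0 ->]] /ratfun_predP[f' [g' [g'0 ->]]].
  apply/ratfun_predP; have [f'0|f'0] := eqVneq f'^@.[q] 0.
    by exists 0, 1; rewrite rmorph0 rmorph1 !hornerE oner_neq0 f'0 !(mul0r, invr0, mulr0).
  exists (f * g'), (g * f').
  rewrite !rmorphM /= !hornerE mulf_neq0 //; split=> //.
  by rewrite invf_div mulf_div.
Qed.
HB.instance Definition _ := GRing.isDivringClosed.Build K ratfun_pred
  ratfun_divring_closed.

Record ratfun := RatFun { ratfun_val : K; _ : ratfun_val \in ratfun_pred }.
HB.instance Definition _ := [isSub for ratfun_val].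
HB.instance Definition _ := [Choice of ratfun by <:].
HB.instance Definition _ := [SubChoice_isSubComUnitRing of ratfun by <:].
HB.instance Definition _ := [SubComUnitRing_isSubIntegralDomain of ratfun by <:].
HB.instance Definition _ := [SubIntegralDomain_isSubField of ratfun by <:].

Lemma ratfun_char0 : [pchar ratfun] =i pred0.
Proof.
by move=> p; rewrite -(fmorph_pchar (val : {rmorphism ratfun -> K})) pchar_num.
Qed.

Lemma ratfun_common_denominator n (a : nat -> ratfun) :
  exists (D : {poly rat}) (c : nat -> {poly rat}), D^@.[q] != 0 /\
    forall i, (i < n)%N -> val (a i) * D^@.[q] = (c i)^@.[q].
Proof.
elim: n => [|n [D [c [D0 Dc]]]].
  by exists 1, (fun=> 0); rewrite rmorph1 -polyC1 hornerC oner_neq0.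
have /ratfun_predP[f [h [h0 Da]]] := valP (a n).
exists (D * h), (fun i => if i == n then f * D else c i * h).
split=> [|i]; first by rewrite rmorphM hornerM mulf_neq0.
rewrite ltnS leq_eqVlt; case: eqVneq => [-> _|_ /= ltin].
  rewrite !rmorphM !hornerM Da [_ * h^@.[q]]mulrC mulrA mulfVK //.
by rewrite !rmorphM !hornerM mulrA Dc.
Qed.

Lemma ratfun_poly_lift (p : {poly K}) : p \is a polyOver ratfun_pred ->
  exists P : {poly ratfun}, map_poly val P = p.
Proof.
move=> /polyOverP pP; exists (\poly_(i < size p) insubd 0 p`_i).
apply/polyP=> i; rewrite coef_map coef_poly.
case: ltnP => [_|lei]; first exact: (insubdK (0 : ratfun) (pP i)).
by rewrite nth_default.
Qed.

Lemma ratfun_const (p : {poly rat}) : p^@ \is a polyOver ratfun_pred.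
Proof.
apply/polyOverP => i; rewrite coef_map; apply/ratfun_predP.
exists (p`_i)%:P, 1; rewrite rmorph1 map_polyC /= -[X in X.[_] != 0]polyC1.
by rewrite -polyC1 !hornerC divr1 oner_neq0.
Qed.

Lemma ratfun_id : q \in ratfun_pred.
Proof.
apply/ratfun_predP; exists 'X, 1.
by rewrite rmorph1 map_polyX hornerX -polyC1 hornerC divr1 oner_neq0.
Qed.

Lemma algebraic_ratr_horner (p : {poly rat}) (x : K) :
  algebraicOver (ratr : rat -> K) x -> algebraicOver (ratr : rat -> K) p^@.[x].
Proof.
move=> algx; elim/poly_ind: p => [|p c IHp].
  by rewrite rmorph0 horner0; apply: algebraic0.
rewrite rmorphD rmorphM /= map_polyX map_polyC hornerD hornerM hornerX hornerC.
by apply/algebraic_add/algebraic_id; apply: algebraic_mul.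
Qed.

Hypothesis q_transc : ~ algebraicOver (ratr : rat -> K) q.

Section Pencil.
Variables (A B : {poly rat}) (x : K).
Hypotheses (copAB : coprimep A B) (ABx : A^@.[x] = q * B^@.[x]).

Lemma pencil_denom_neq0 : B^@.[x] != 0.
Proof.
apply/eqP => Bx; have : coprimep A^@ B^@ by rewrite coprimep_map.
move/coprimep_root => /(_ x); rewrite /root ABx Bx mulr0 eqxx => /(_ isT).
by [].
Qed.

Lemma pencil_root_transc : ~ algebraicOver (ratr : rat -> K) x.
Proof.
move=> algx; apply: q_transc; have B0 := pencil_denom_neq0.
rewrite -[q](mulfK B0) -ABx.
by apply: algebraic_div; apply: algebraic_ratr_horner.
Qed.

Lemma pencil_param_neq0 : q != 0.
Proof. by apply: contra_not_neq q_transc => ->; apply: algebraic0. Qed.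

(** Multiplied by a power of [B.[x]], the relation becomes a rational polynomial vanishing at the
    transcendental [x], hence zero. Modulo [A] only the term of [H 0] survives, so [A] divides [H 0]
    by coprimality and [H 0 = 0] by degree; then divide by [q] and induct. *)
Lemma pencil_free d (H : nat -> {poly rat}) :
  (forall k, (size (H k) < size A)%N) ->
  \sum_(k < d) (H k)^@.[x] * q ^+ k = 0 -> forall k, (k < d)%N -> H k = 0.
Proof.
elim: d H => // d IHd H sH sumH0.
pose Z := \sum_(k < d.+1) H k * A ^+ k * B ^+ (d - k).
have Z0 : Z = 0.
  apply: contra_not_eq pencil_root_transc => Z0.
  exists Z => //; rewrite /root rmorph_sum horner_sum.
  rewrite (eq_bigr (fun k : 'I_d.+1 => (H k)^@.[x] * q ^+ k * B^@.[x] ^+ d)).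
    by rewrite -mulr_suml sumH0 mul0r.
  move=> k _; rewrite !rmorphM !rmorphXn !hornerM !horner_exp ABx exprMn.
  by rewrite -!mulrA -exprD subnKC // -ltnS.
have H0 : H 0 = 0.
  have : A %| H 0 * B ^+ d.
    move: Z0; rewrite /Z big_ord_recl expr0 mulr1 subn0 => /eqP.
    rewrite addr_eq0 => /eqP->; rewrite dvdpNr; apply: (big_ind (fun p => A %| p)) => //.
      by move=> *; apply: dvdp_add.
    by move=> i _; rewrite dvdp_mulr // dvdp_mull // lift0 exprS dvdp_mulr.
  rewrite Gauss_dvdpl ?coprimep_expr // => AH.
  by apply/eqP; apply: contraTT (sH 0) => H0; rewrite -leqNgt dvdp_leq.
case=> [|k] //; rewrite ltnS => ltkd; apply: (IHd (fun k => H k.+1)) => //.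
move: sumH0; rewrite big_ord_recl H0 rmorph0 horner0 mul0r add0r.
under eq_bigr do rewrite exprS mulrCA.
by rewrite -mulr_sumr => /eqP; rewrite mulf_eq0 (negPf pencil_param_neq0) => /eqP.
Qed.

(** Clear the denominators of [g] and sort the relation by powers of [q] instead of powers of [x]:
    the coefficient of [q ^+ k] is [(H k).[x]], with [H k] no larger than [g], and [pencil_free]
    applies. *)
Lemma pencil_minimal (g : {poly ratfun}) : (size g < size A)%N ->
  root (map_poly val g) x -> g = 0.
Proof.
move=> sg gx; have [D [c [D0 Dc]]] := ratfun_common_denominator (size g) (fun i => g`_i).
pose d := \max_(i < size g) size (c i).
pose H k := \poly_(i < size g) (c i)`_k.
have Hx k : (H k)^@.[x] = \sum_(i < size g) ratr (c i)`_k * x ^+ i.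
  rewrite -(horner_poly _ (fun i => ratr (c i)`_k)); congr _.[x]; apply/polyP => i.
  rewrite coef_map /H !coef_poly; case: ifP => // _.
  exact: rmorph0.
have H0 : forall k, (k < d)%N -> H k = 0.
  apply: pencil_free => [k|]; first exact: leq_ltn_trans (size_poly _ _) sg.
  have := congr1 (fun y => y * D^@.[q]) (rootP gx).
  rewrite mul0r horner_coef size_map_poly mulr_suml => Dg; apply: etrans Dg.
  under eq_bigr do rewrite Hx mulr_suml.
  rewrite exchange_big /=; apply: eq_bigr => i _.
  rewrite (coef_map (val : {rmorphism ratfun -> K})) mulrAC /= Dc //.
  rewrite horner_coef size_map_poly mulr_suml.
  have leid : (size (c i) <= d)%N.
    exact: (@leq_bigmax _ (fun j : 'I_(size g) => size (c j)) i).
  rewrite (big_ord_widen _ (fun k => ((c i)^@)`_k * q ^+ k * x ^+ i) leid).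
  rewrite [RHS]big_mkcond; apply: eq_bigr => k _ /=.
  rewrite coef_map; case: ltnP => [_|lek]; first by rewrite mulrAC.
  by rewrite nth_default // rmorph0 !mul0r.
apply/polyP => i; rewrite coef0; have [lti|lei] := ltnP i (size g); last first.
  by rewrite nth_default.
have ci0 : c i = 0.
  apply/polyP => k; rewrite coef0; have [ltk|lek] := ltnP k d.
    have := congr1 (fun p : {poly rat} => p`_i) (H0 k ltk).
    by rewrite coef_poly lti coef0.
  rewrite nth_default // (leq_trans _ lek) //.
  exact: (@leq_bigmax _ (fun j : 'I_(size g) => size (c j)) (Ordinal lti)).
have := Dc i lti; rewrite ci0 rmorph0 horner0 => /eqP.
by rewrite mulf_eq0 (negPf D0) orbF => /eqP g0; apply: val_inj.
Qed.

(** [A - q B] is monic of degree [size B], vanishes at [x], and is minimal by [pencil_minimal]; its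
    subleading coefficient is [subcoef A - q]. *)
Lemma ntrace_pencil : A \is monic -> B \is monic -> size A = (size B).+1 ->
  exists2 t : ratfun, ntrace val x t &
    val t = (q - ratr (subcoef A)) / (size B)%:R.
Proof.
move=> mA mB sAB; have sB : (0 < size B)%N by rewrite size_poly_gt0 monic_neq0.
have [n sBn] : exists n, size B = n.+1 by case: (size B) sB => // n; exists n.
have [P DP] : exists P : {poly ratfun}, map_poly val P = A^@ - q *: B^@.
  apply: ratfun_poly_lift; rewrite rpredB ?ratfun_const //.
  apply/polyOverP => i; rewrite coefZ rpredM ?ratfun_id //.
  by rewrite (polyOverP (ratfun_const B)).
have sqB : (size (- (q *: B^@)) < size A^@)%N.
  by rewrite size_polyN (leq_ltn_trans (size_scale_leq _ _)) // !size_map_poly sAB.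
have sP : size P = n.+2.
  rewrite -(size_map_poly (val : {rmorphism ratfun -> K})) DP size_polyDl //.
  by rewrite size_map_poly sAB sBn.
have mP : P \is monic.
  rewrite -(map_monic (val : {rmorphism ratfun -> K})) DP monicE lead_coefDl //.
  by rewrite lead_coef_map (monicP mA) rmorph1.
exists (- subcoef P / (n.+1)%:R); last first.
  rewrite sBn rmorphM fmorphV rmorph_nat rmorphN; congr (_ / _).
  rewrite (subcoefE sP) -coef_map DP coefB coefZ !coef_map /=.
  rewrite (@subcoefE _ A n) ?sAB ?sBn // opprB; congr (_ - _).
  by have := monicP mB; rewrite lead_coefE sBn => /= ->; rewrite rmorph1 mulr1.
exists P; last first.
  by rewrite sP -[LHS]mulr_natr mulfVK // ((pcharf0P _).1 ratfun_char0).
split=> // [|g gx].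
  by rewrite DP /root !hornerE /= ABx subrr.
rewrite /dvdp; apply/eqP; apply: pencil_minimal.
  by rewrite sAB sBn -sP ltn_modp monic_neq0.
move: gx; rewrite {1}(divp_eq g P) rmorphD rmorphM /= /root hornerD hornerM DP.
by rewrite !hornerE /= ABx subrr mulr0 add0r.
Qed.
End Pencil.
End RationalFunctionsAt.

(** * Polynomial solutions of ('X - M) w = a b *)

(** Deleting a vertex numbers the others by [lift] in a cofactor and by [enum_rank] in the deleted
    graph; the two orders differ by one permutation of both rows and columns. *)
Lemma det_fmx (R : comNzRingType) (T : finType) (N : T -> T -> R) n (f : 'I_n -> T) :
  injective f -> n = #|T| -> \det (\matrix_(i, j) N (f i) (f j)) = \det (fmx N).
Proof.
move=> f_inj En; subst n.
have s_inj : injective (fun i => enum_rank (f i)) by move=> i j /enum_rank_inj/f_inj.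
pose s := perm s_inj.
have -> : \matrix_(i, j) N (f i) (f j) = row_perm s (col_perm s (fmx N)).
  by apply/matrixP => i j; rewrite !mxE !permE !enum_rankK.
rewrite row_permE col_permE !det_mulmx !det_perm odd_permV mulrCA -expr2.
by rewrite -exprM mulnC exprM sqrrN expr1n expr1n mulr1.
Qed.

Section CharPolyFinType.
Variable R : comNzRingType.

Lemma char_poly_mx_fmx (T : finType) (N : T -> T -> R) :
  char_poly_mx (fmx N) = fmx (fun x y => 'X *+ (x == y) - (N x y)%:P).
Proof.
by apply/matrixP => i j; rewrite !mxE (inj_eq enum_val_inj).
Qed.

(** Turns cospectrality into the equality of two diagonal entries of one adjugate matrix. *)
Lemma adj_char_poly_fmx (T : finType) (N : T -> T -> R) (u : T) :
  (\adj (char_poly_mx (fmx N))) (enum_rank u) (enum_rank u) =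
  char_poly (fmx (fun x y : {x | x \notin [set u]} => N (val x) (val y))).
Proof.
rewrite mxE /cofactor addnn -mul2n exprM sqrrN !expr1n mul1r /char_poly.
rewrite !char_poly_mx_fmx.
have fP (i : 'I_#|T|.-1) : enum_val (lift (enum_rank u) i) \notin [set u].
  rewrite inE -(inj_eq enum_rank_inj) enum_valK eq_sym; exact: neq_lift.
pose f i : {x | x \notin [set u]} := Sub (enum_val (lift (enum_rank u) i)) (fP i).
have f_inj : injective f by move=> i j /(congr1 val) /enum_val_inj/lift_inj.
have En : #|T|.-1 = #|{: {x | x \notin [set u]}}|.
  by rewrite card_sig -(cardC1 u); apply: eq_card => x; rewrite !inE.
apply: etrans (det_fmx _ f_inj En); congr (\det _); apply/matrixP => i j.
by rewrite !mxE -val_eqE.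
Qed.
End CharPolyFinType.

Section KrylovPolynomials.
Variables (F : realFieldType) (V : finType) (M : V -> V -> F).
Hypothesis M_sym : forall i j, M i j = M j i.
Implicit Types (w z : V -> {poly F}) (b y : V -> F) (a g h : {poly F}).

Definition xsub w i : {poly F} := 'X * w i - \sum_j M i j *: w j.

Lemma xsubD w z i : xsub (fun j => w j + z j) i = xsub w i + xsub z i.
Proof.
rewrite /xsub mulrDr; under eq_bigr do rewrite scalerDr.
by rewrite big_split opprD addrACA.
Qed.

Lemma xsubMl g w i : xsub (fun j => g * w j) i = g * xsub w i.
Proof.
rewrite /xsub mulrBr mulrCA mulr_sumr; congr (_ - _).
by apply: eq_bigr => j _; rewrite scalerAr.
Qed.

Lemma xsubB w z i : xsub (fun j => w j - z j) i = xsub w i - xsub z i.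
Proof.
rewrite -[- xsub z i]mulN1r -xsubMl -xsubD.
by congr xsub; apply/funext => j; rewrite mulN1r.
Qed.

Lemma xsub_sym w z : \sum_i w i * xsub z i = \sum_i z i * xsub w i.
Proof.
rewrite /xsub; under eq_bigr do rewrite mulrBr.
under [RHS]eq_bigr do rewrite mulrBr.
rewrite !sumrB; congr (_ - _).
  by apply: eq_bigr => i _; rewrite mulrCA [w i * z i]mulrC mulrCA.
under eq_bigr do rewrite mulr_sumr.
rewrite exchange_big; apply: eq_bigr => i _; rewrite mulr_sumr.
by apply: eq_bigr => j _; rewrite M_sym -!scalerAr mulrC.
Qed.

(** At an entry [j] where [z] has maximal size nothing cancels the top term of ['X * z j], so [g] is
    larger than [z j]. *)
Lemma xsub_size g y z : (forall i, xsub z i = g * (y i)%:P) ->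
  forall i, (size (z i) <= (size g).-1)%N.
Proof.
move=> zg i; have [j _ /(_ _ isT) jmax] := @arg_maxnP V i predT (fun i => size (z i)) isT.
have {jmax} jmax k : (size (z k) <= size (z j))%N by apply: jmax.
apply: leq_trans (jmax i) _; have [->|zj0] := eqVneq (z j) 0.
  by rewrite size_poly0.
have sX : size ('X * z j) = (size (z j)).+1.
  by rewrite mulrC size_mulX.
have sM : (size (- \sum_k M j k *: z k) < size ('X * z j)%R)%N.
  rewrite size_polyN sX ltnS; apply: leq_trans (size_sum _ _ _) _.
  apply/bigmax_leqP => k _; exact: leq_trans (size_scale_leq _ _) (jmax k).
have := size_polyDl sM; rewrite -/(xsub z j) zg sX => sg.
have : (size (g * (y j)%:P)%R <= size g)%N.
  by rewrite mulrC mul_polyC size_scale_leq.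
by rewrite sg; case: (size g).
Qed.

Lemma xsub_lead g y z : (1 < size g)%N -> (forall i, xsub z i = g * (y i)%:P) ->
  forall i, (z i)`_(size g).-2 = lead_coef g * y i.
Proof.
move=> sg zg i; have := congr1 (fun p : {poly F} => p`_(size g).-1) (zg i).
rewrite /xsub coefB coefXM coefMC lead_coefE coef_sum big1 => [|j _].
  by rewrite subr0 -subn1 subn_eq0 leqNgt sg subn1.
by rewrite coefZ nth_default ?mulr0 // (xsub_size zg).
Qed.

(** Division of [h b] by ['X - M], following Horner's scheme: the remainder [y] is the vector
    [h(M) b]. *)
Lemma xsub_divide h b : exists w y, forall i, xsub w i = h * (b i)%:P - (y i)%:P.
Proof.
elim/poly_ind: h => [|h c [w [y IHh]]].
  exists (fun=> 0), (fun=> 0) => i.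
  rewrite /xsub mulr0 big1 => [|j _]; last by rewrite scaler0.
  by rewrite mul0r polyC0.
exists (fun i => 'X * w i + (y i)%:P).
exists (fun i => \sum_j M i j * y j + c * b i) => i.
rewrite xsubD xsubMl IHh /xsub polyCD rmorph_sum /=.
under eq_bigr do rewrite -mul_polyC -polyCM.
rewrite [(c * _)%:P]polyCM; ring.
Qed.

(** [a] is the minimal polynomial of [M] at [b]. Suppose a nonconstant [g] divides both [a = h g]
    and the product of [b] with [w]. Then [y = h(M) b] is nonzero by minimality, and
    [('X - M) z = g y] for some [z]; the product of [y] with [z] is divisible by [g], of smaller
    degree than [g], and nonzero because its top coefficient is a multiple of the squared length of
    [y]. *)
Lemma xsub_coprime b :
    (exists2 a : {poly F}, a != 0 & exists w, forall i, xsub w i = a * (b i)%:P) ->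
  exists a w, [/\ a \is monic, forall i, xsub w i = a * (b i)%:P
    & coprimep a (\sum_i b i *: w i)].
Proof.
pose ann m := `[< exists2 a : {poly F}, a != 0 & size a = m /\
  exists w, forall i, xsub w i = a * (b i)%:P >].
case=> a0 a0nz [w0 w0P].
have exann : exists m, ann m.
  by exists (size a0); apply/asboolP; exists a0 => //; split=> //; exists w0.
case: (ex_minnP exann) => m /asboolP[a1 a1nz [sa1 [w1 w1P]]] minm.
pose a := (lead_coef a1)^-1%:P * a1; pose w i := (lead_coef a1)^-1%:P * w1 i.
have lg0 : (lead_coef a1)^-1 != 0 by rewrite invr_eq0 lead_coef_eq0.
have sa : size a = m by rewrite /a mul_polyC size_scale.
have wP i : xsub w i = a * (b i)%:P by rewrite xsubMl w1P mulrA.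
have ma : a \is monic.
  by rewrite monicE /a mul_polyC lead_coefZ mulVf // lead_coef_eq0.
have a_nz := monic_neq0 ma.
exists a, w; split=> //; rewrite /coprimep; apply/negPn/negP => sg1.
set g := gcdp _ _ in sg1.
have g_nz : g != 0 by rewrite gcdp_eq0 (negPf a_nz).
have sg : (1 < size g)%N.
  by move: sg1; rewrite neq_ltn ltnS leqn0 size_poly_eq0 (negPf g_nz).
have /dvdpP[h Dh] : g %| a by apply: dvdp_gcdl.
have /dvdpP[r Dr] : g %| \sum_i b i *: w i by apply: dvdp_gcdr.
have h_nz : h != 0 by apply: contraNneq a_nz => h0; rewrite Dh h0 mul0r.
have [wh [y whP]] := xsub_divide h b.
pose z i := w i - g * wh i.
have zP i : xsub z i = g * (y i)%:P.
  have -> : xsub z i = xsub w i - g * xsub wh i by rewrite -xsubMl -xsubB.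
  by rewrite wP whP Dh; ring.
have yz_nz : exists i, y i != 0.
  apply/existsP; apply: contraT; rewrite negb_exists => /forallP y0.
  have : ann (size h).
    apply/asboolP; exists h => //; split=> //; exists wh => i.
    by rewrite whP (eqP (negPn (y0 i))) subr0.
  move/minm; rewrite -sa Dh size_mul // leqNgt => /negP; case.
  have := sg; have := size_poly_gt0 h; rewrite h_nz.
  by set m1 := size h; set m2 := size g; lia.
(* Squares do not cancel, [F] being ordered. *)
have syy : \sum_i y i * y i != 0.
  have [i yi] := yz_nz; rewrite psumr_neq0 => [|j _]; last by rewrite -expr2 sqr_ge0.
  by apply/hasP; exists i; rewrite ?mem_index_enum //= -expr2 exprn_even_gt0 ?yi.
pose s := \sum_i (y i)%:P * z i.
(* Write [y] as [h b - ('X - M) wh] and move ['X - M] onto [z] by symmetry; every term then carries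
   the factor [g]. *)
have gs : g %| s.
  have -> : s = \sum_i (h * (b i)%:P) * z i - \sum_i z i * xsub wh i.
    by rewrite -sumrB; apply: eq_bigr => i _; rewrite whP; ring.
  rewrite -xsub_sym dvdp_sub //.
    have -> : \sum_i (h * (b i)%:P) * z i = h * (r * g) - g * h * \sum_i b i *: wh i.
      rewrite -Dr !mulr_sumr -sumrB; apply: eq_bigr => i _.
      by rewrite -!mul_polyC /z; ring.
    by rewrite dvdp_sub // ?mulrA ?dvdp_mulIr // -mulrA dvdp_mulIl.
  apply: (big_ind (fun p => g %| p)) => [|p q gp gq|i _]; first exact: dvdp0.
    exact: dvdp_add.
  by rewrite zP mulrCA dvdp_mulIl.
have ss : s`_(size g).-2 = lead_coef g * \sum_i y i * y i.
  rewrite coef_sum mulr_sumr; apply: eq_bigr => i _.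
  by rewrite coefCM (xsub_lead sg zP) mulrCA.
have s_nz : s != 0.
  apply: contraNneq syy => s0; move/eqP: ss.
  by rewrite s0 coef0 eq_sym mulf_eq0 lead_coef_eq0 (negPf g_nz).
have := dvdp_leq s_nz gs; rewrite leqNgt => /negP; apply.
suff: (size s <= (size g).-1)%N by move: sg; case: (size g).
apply: leq_trans (size_sum _ _ _) _; apply/bigmax_leqP => i _.
rewrite mul_polyC; exact: leq_trans (size_scale_leq _ _) (xsub_size zP i).
Qed.

Definition colpoly w : 'cV[{poly F}]_#|V| := \col_i w (enum_val i).

Lemma char_poly_mx_col w i :
  (char_poly_mx (fmx M) *m colpoly w) i 0 = xsub w (enum_val i).
Proof.
rewrite mxE /xsub.
under eq_bigr do rewrite !mxE mulrBl mulrnAl.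
rewrite sumrB; congr (_ - _).
  by rewrite (bigD1 i) //= eqxx big1 ?addr0 // => j /negPf; rewrite eq_sym => ->.
rewrite [RHS](reindex (enum_val : 'I_#|V| -> V)) /=; last first.
  by apply: onW_bij; exists enum_rank; [apply: enum_valK | apply: enum_rankK].
by apply: eq_bigr => j _; rewrite mul_polyC.
Qed.

Lemma xsub_adj_ex b : exists2 a : {poly F}, a != 0 &
  exists w, forall i, xsub w i = a * (b i)%:P.
Proof.
exists (char_poly (fmx M)); first exact/monic_neq0/char_poly_monic.
pose W := \adj (char_poly_mx (fmx M)) *m colpoly (fun i => (b i)%:P).
exists (fun i => W (enum_rank i) 0) => i.
rewrite -[in LHS](enum_rankK i) -char_poly_mx_col.
have -> : colpoly (fun i => W (enum_rank i) 0) = W.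
  by apply/matrixP => j k; rewrite mxE enum_valK ord1.
by rewrite mulmxA mul_mx_adj mul_scalar_mx !mxE enum_rankK.
Qed.

Lemma xsub_adj a b w i : (forall i, xsub w i = a * (b i)%:P) ->
  char_poly (fmx M) * w i = a * \sum_j
    (\adj (char_poly_mx (fmx M))) (enum_rank i) (enum_rank j) * (b j)%:P.
Proof.
move=> wP; have : char_poly_mx (fmx M) *m colpoly w = a *: colpoly (fun i => (b i)%:P).
  by apply/matrixP => j k; rewrite ord1 char_poly_mx_col wP !mxE.
move/(congr1 (mulmx (\adj (char_poly_mx (fmx M))))).
rewrite mulmxA mul_adj_mx mul_scalar_mx -scalemxAr => /matrixP/(_ (enum_rank i) 0).
rewrite mxE [colpoly w _ _]mxE enum_rankK => ->; rewrite mxE; congr (_ * _).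
rewrite mxE.
rewrite (reindex enum_rank) /=; last first.
  by apply: onW_bij; exists enum_val; [apply: enum_rankK | apply: enum_valK].
by apply: eq_bigr => j _; rewrite [colpoly _ _ _]mxE (enum_rankK j).
Qed.

Lemma adj_char_poly_sym i j :
  (\adj (char_poly_mx (fmx M))) i j = (\adj (char_poly_mx (fmx M))) j i.
Proof.
have {1}<- : (char_poly_mx (fmx M))^T = char_poly_mx (fmx M).
  by apply/matrixP => k l; rewrite !mxE eq_sym M_sym.
by rewrite -trmx_adj mxE.
Qed.

(** By Cramer's rule the characteristic polynomial times [w] is [a] times the adjugate applied to
    [b]. The adjugate is symmetric with equal diagonal entries at [u] and [v], so exchanging [u] and
    [v] multiplies the result by [e]. *)
Lemma xsub_cospectral (u v : V) (e : F) a b w :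
  char_poly (fmx (fun x y : {x | x \notin [set u]} => M (val x) (val y))) =
  char_poly (fmx (fun x y : {x | x \notin [set v]} => M (val x) (val y))) ->
  u != v -> e * e = 1 -> b =1 (fun i => (i == u)%:R + e * (i == v)%:R) ->
  (forall i, xsub w i = a * (b i)%:P) -> w v = e%:P * w u.
Proof.
rewrite -!adj_char_poly_fmx => cosp neq_uv ee bE wP.
have chi0 := monic_neq0 (char_poly_monic (fmx M)).
have vu : (v == u) = false by rewrite eq_sym (negPf neq_uv).
have sumE i : \sum_j (\adj (char_poly_mx (fmx M))) (enum_rank i) (enum_rank j) * (b j)%:P
   = (\adj (char_poly_mx (fmx M))) (enum_rank i) (enum_rank u)
     + e%:P * (\adj (char_poly_mx (fmx M))) (enum_rank i) (enum_rank v).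
  rewrite (bigD1 u) // (bigD1 v) 1?eq_sym //= big1 => [|j /andP[/negPf ju /negPf jv]].
    rewrite !bE !eqxx vu (negPf neq_uv) mulr0 !addr0 !mulr1 add0r.
    by rewrite mulrC.
  by rewrite bE ju jv mulr0 addr0 mulr0.
apply: (mulfI chi0); rewrite mulrCA !(xsub_adj _ wP) !sumE -cosp.
rewrite (adj_char_poly_sym (enum_rank v)) mulrCA; congr (_ * _).
by rewrite mulrDr mulrA -polyCM ee mul1r addrC.
Qed.

Lemma xsub_monic (u : V) a b w : a \is monic -> (1 < size a)%N -> b u = 1 ->
  (forall i, xsub w i = a * (b i)%:P) -> w u \is monic /\ size a = (size (w u)).+1.
Proof.
move=> ma sa bu wP; have wu := xsub_lead sa wP u.
rewrite (monicP ma) bu mulr1 in wu.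
have su : size (w u) = (size a).-1.
  apply/eqP; rewrite eqn_leq (xsub_size wP) /= leqNgt; apply/negP => lts.
  move/eqP: wu; rewrite nth_default ?(eq_sym 0) ?oner_eq0 //.
  by move: sa lts; case: (size a) => [|[]].
by rewrite monicE lead_coefE su wu eqxx; case: (size a) sa.
Qed.
End KrylovPolynomials.

(** * Pencils of cospectral vertices and the effect of a diagonal shift *)

Section Pencils.

(* [pencil_data M u v e a m w]: w is the vector of polynomials m (1, e) on (u, v)
   extended so that ('X - M) w = a (1, e), the right-hand side being supported
   on u and v; thus a / m is the Schur complement of 'X - M in direction (1, e). *)
Definition pencil_data (V : finType) (M : V -> V -> rat) (u v : V) (e : rat)
    (a m : {poly rat}) (w : V -> {poly rat}) : Prop :=
  [/\ [/\ a \is monic, m \is monic, size a = (size m).+1 & coprimep a m],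
      w u = m, w v = e%:P * m &
      forall i, xsub M w i = a * ((i == u)%:R + e * (i == v)%:R)%:P].

Lemma char_poly_ratr (R : realType) (G : sgraph) :
  char_poly (adjmx R G) = map_poly ratr (char_poly (adjmx rat G)).
Proof.
rewrite (map_char_poly (ratr : {rmorphism rat -> R})); congr char_poly.
by apply/matrixP => i j; rewrite !mxE rmorph_nat.
Qed.

(** Since [w v = e w u] with [e * e = 1], the product of [b] with [w] is [2 w u]; the coprimality
    given by [xsub_coprime] is thus coprimality with [m = w u]. *)
Lemma cospectral_pencil (R : realType) (G : sgraph) (u v : G) (e : rat) :
  u != v -> cospectral R u v -> e * e = 1 ->
  exists a m w, pencil_data (fun x y => (edge x y)%:R) u v e a m w.
Proof.
move=> neq_uv cosp ee; pose M (x y : G) : rat := (edge x y)%:R.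
have M_sym x y : M x y = M y x by rewrite /M edge_sym.
pose b (i : G) : rat := (i == u)%:R + e * (i == v)%:R.
have vu : (v == u) = false by rewrite eq_sym (negPf neq_uv).
have bu : b u = 1 by rewrite /b eqxx (negPf neq_uv) mulr0 addr0.
have bv : b v = e by rewrite /b eqxx vu mulr1 add0r.
have [a [w [ma wP cop]]] := xsub_coprime M_sym (xsub_adj_ex M b).
have wv : w v = e%:P * w u.
  apply: (xsub_cospectral M_sym _ neq_uv ee _ wP) => //.
  (* Cospectrality is stated over [R], but both characteristic polynomials come from rational
     ones. *)
  apply: (map_inj_poly (f := ratr : rat -> R)); [exact: fmorph_inj|exact: rmorph0|].
  by move: cosp; rewrite /cospectral !char_poly_ratr.
(* A constant [a] would force [w = 0] by the size bound, and then [a b = 0]. *)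
have sa : (1 < size a)%N.
  rewrite ltnNge; apply/negP => sa1; have := xsub_size wP.
  have -> : (size a).-1 = 0 by move: sa1; case: (size a) => [|[]].
  move=> w0; have := wP u; have wi i : w i = 0 by apply/eqP; rewrite -size_poly_leq0.
  rewrite /xsub wi mulr0 big1 => [|j _]; last by rewrite wi scaler0.
  rewrite subr0 bu polyC1 mulr1 => /esym/eqP.
  by rewrite (negPf (monic_neq0 ma)).
have [mw sw] := xsub_monic ma sa bu wP.
exists a, (w u), w; split=> //; split=> //.
have : coprimep a ((2%:R : rat)%:P * w u).
  suff -> : 2%:P * w u = \sum_i b i *: w i by [].
  rewrite (bigD1 u) // (bigD1 v) ?vu //= big1 => [|j /andP[/negPf ju /negPf jv]].
    rewrite bu bv wv scale1r addr0 -mul_polyC mulrA -polyCM ee mul1r.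
    by rewrite -[2]/(1 + 1) polyCD mulrDl mul1r.
  by rewrite /b ju jv mulr0 addr0 scale0r.
by rewrite mul_polyC coprimepZr.
Qed.

Section Shift.
Variables (V : finType) (M : V -> V -> rat) (u v : V) (e c : rat).
Local Notation "p ^s" := (p \Po ('X - c%:P)) (at level 2, format "p ^s").

Lemma monic_shift (p : {poly rat}) : p \is monic -> p^s \is monic.
Proof.
move=> /monicP lp; rewrite monicE lead_coef_comp ?size_XsubC // lp.
by rewrite lead_coefXsubC expr1n mulr1.
Qed.

Lemma size_shift (p : {poly rat}) : size p^s = size p.
Proof. by rewrite size_comp_poly2 ?size_XsubC. Qed.

(** Substituting ['X - c] translates each of the [(size p).-1] roots by [c]. *)
Lemma subcoef_shift (p : {poly rat}) : p \is monic ->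
  subcoef p^s = subcoef p - c *+ (size p).-1.
Proof.
move=> mp; case sp: (size p) => [|[|n]].
- by have := monic_neq0 mp; rewrite -size_poly_eq0 sp.
- by rewrite (monic_size1 mp sp) comp_polyC subcoef1 subr0.
have [s ps ss] := monic_split mp sp.
have sX : size (('X - c%:P) ^+ n.+1) = n.+2 by rewrite size_exp_XsubC.
rewrite (@subcoefE _ _ n) ?size_shift // (subcoefE sp).
rewrite {1}ps comp_polyD comp_Xn_poly coefD -(subcoefE sX) subcoefX ?monicXsubC //.
rewrite (@subcoefE _ _ 0) ?size_XsubC // coefB coefX coefC /= sub0r.
rewrite mulNrn addrC; congr (_ - _).
have -> : p`_n = s`_n by rewrite ps coefD coefXn ltn_eqF // add0r.
move: ss; rewrite leq_eqVlt => /orP[/eqP ss|ss].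
  have := lead_coef_comp s (q := 'X - c%:P); rewrite size_XsubC => /(_ isT).
  by rewrite lead_coefXsubC expr1n mulr1 !lead_coefE size_shift ss.
by rewrite !nth_default ?size_shift.
Qed.

Lemma pencil_data_shift a m w : pencil_data M u v e a m w ->
  pencil_data (fun x y => M x y + c *+ (x == y)) u v e a^s m^s (fun i => (w i)^s).
Proof.
case=> [[ma mm sam cop] wu wv wP]; split.
- by split; rewrite ?monic_shift ?size_shift //; apply: coprimep_comp_poly.
- by rewrite wu.
- by rewrite wv comp_polyM comp_polyC.
move=> i; rewrite -[X in _ * X](comp_polyC _ ('X - c%:P)) -comp_polyM -wP /xsub.
rewrite comp_polyB comp_polyM comp_polyX mulrBl -addrA; congr (_ + _).
under eq_bigr do rewrite scalerDl.
rewrite big_split /= opprD [RHS]addrC; congr (_ + _).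
  congr (- _); rewrite [RHS]linear_sum; apply: eq_bigr => j _.
  by rewrite /= comp_polyZ.
rewrite (bigD1 i) //= eqxx big1 ?addr0 => [|j ji]; first by rewrite mul_polyC.
by rewrite eq_sym (negPf ji) scale0r.
Qed.
End Shift.
End Pencils.

(** * The even and odd pencils of a path of odd order *)

Section PathPencil.

(* The Chebyshev recurrence, run outwards from the middle vertex of the path. *)
Fixpoint chebrec (t0 t1 : {poly rat}) n : {poly rat} :=
  if n is n'.+1 then chebrec t1 ('X * t1 - t0) n' else t0.

Lemma chebrecSS t0 t1 n :
  chebrec t0 t1 n.+2 = 'X * chebrec t0 t1 n.+1 - chebrec t0 t1 n.
Proof. by elim: n t0 t1 => [|n IHn] t0 t1 //=; apply: IHn. Qed.

(** Each recurrence step is a step of Euclid's algorithm, which preserves coprimality; [t0] is too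
    small to touch the subleading coefficient of ['X * t1]. *)
Lemma chebrec_monic (t0 t1 : {poly rat}) d n :
    size t0 = d -> t1 \is monic -> size t1 = d.+1 -> subcoef t1 = 0 -> coprimep t1 t0 ->
  [/\ size (chebrec t0 t1 n) = (n + d)%N, chebrec t0 t1 n.+1 \is monic,
      subcoef (chebrec t0 t1 n.+1) = 0 &
      coprimep (chebrec t0 t1 n.+1) (chebrec t0 t1 n)].
Proof.
elim: n t0 t1 d => [|n IHn] t0 t1 d st0 mt1 st1 ct1 cop; first by split.
have m1 := monic_neq0 mt1.
have sX : size ('X * t1) = d.+2 by rewrite mulrC size_mulX ?st1.
have st0N : (size (- t0) < size ('X * t1)%R)%N by rewrite size_polyN st0 sX.
have s2 : size ('X * t1 - t0) = d.+2 by rewrite size_polyDl.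
have [|||||sn mn cn copn] := IHn t1 ('X * t1 - t0) d.+1 => //.
- by rewrite monicE lead_coefDl // lead_coefM lead_coefX mul1r -monicE.
- rewrite (subcoefE s2) coefB [t0`_d]nth_default ?st0 // subr0.
  have mX : 'X * t1 \is monic by rewrite monicMl ?monicX.
  rewrite -(subcoefE sX) subcoefM ?monicX // ct1 addr0.
  by rewrite (@subcoefE _ _ 0) ?size_polyX // coefX.
- by rewrite coprimep_sym coprimep_addl_mul -scaleN1r coprimepZr ?oppr_eq0 ?oner_eq0.
by split=> //; rewrite sn addnS addSn.
Qed.

Lemma sum_path_edge k (f : nat -> {poly rat}) (i : 'I_k) :
  \sum_(j < k) (path_edge i j)%:R *: f j =
    (if (i.+1 < k)%N then f i.+1 else 0) + (if (0 < i)%N then f i.-1 else 0).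
Proof.
have sum1 m : \sum_(j < k) ((m == j :> nat)%:R : rat) *: f j = if (m < k)%N then f m else 0.
  case: ltnP => [ltmk|lekm].
    rewrite (bigD1 (Ordinal ltmk)) //= eqxx scale1r big1 ?addr0 // => j.
    by rewrite -val_eqE /= eq_sym => /negPf->; rewrite scale0r.
  by rewrite big1 // => j _; rewrite gtn_eqF ?scale0r // (leq_trans (ltn_ord j)).
rewrite -[if (i.+1 < k)%N then _ else _]sum1.
have -> : (if (0 < i)%N then f i.-1 else 0) =
    \sum_(j < k) ((0 < i)%N && (i.-1 == j :> nat))%:R *: f j.
  case: ifP => i0 /=; last by rewrite big1 // => j _; rewrite scale0r.
  by rewrite sum1 (leq_ltn_trans (leq_pred _)).
rewrite -big_split /=; apply: eq_bigr => j _; rewrite -scalerDl -natrD; congr (_%:R *: _).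
rewrite /path_edge; case: i j => i ? [j ?] /=; lia.
Qed.

(** The solution is even ([s] true) or odd about the middle vertex [c]: at distance [n] its entry is
    [T_ n], times [e] beyond the middle. Up to scaling these are Chebyshev polynomials in ['X / 2],
    of the first kind from [2, 'X] and of the second from [0, 1]; the endpoints give [m = T_ c] and
    [a = T_ c.+1]. *)
Lemma path_pencil k (pu pv : 'I_k) (e : rat) (s : bool) :
  (3 <= k)%N -> odd k -> pu = 0 :> nat -> pv = k.-1 :> nat -> e = (-1) ^+ (~~ s) ->
  exists a m w,
    [/\ pencil_data (fun x y : 'I_k => (path_edge x y)%:R) pu pv e a m w,
        size m = (k./2 + s)%N & subcoef a = 0].
Proof.
move=> k3 kodd pu0 pvk De; have [c Dk ->] : exists2 c, k = (c.*2).+1 & k./2 = c.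
  by exists k./2 => //; rewrite -[LHS]odd_double_half kodd.
have c0 : (0 < c)%N by move: k3; rewrite Dk; case: (c).
have ee : e * e = 1 by rewrite De -expr2 exprAC sqrrN !expr1n.
pose t0 : {poly rat} := if s then 2 else 0; pose t1 : {poly rat} := if s then 'X else 1.
have st0 : size t0 = s.
  by rewrite /t0; case: (s); rewrite ?size_poly0 // -polyC_natr size_polyC.
have mt1 : t1 \is monic by rewrite /t1; case: (s); rewrite ?monicX ?monic1.
have st1 : size t1 = s.+1 by rewrite /t1; case: (s); rewrite ?size_polyX ?size_poly1.
have ct1 : subcoef t1 = 0.
  by rewrite /t1; case: (s); rewrite ?subcoef1 // (@subcoefE _ _ 0) ?size_polyX // coefX.
have cop : coprimep t1 t0.
  rewrite /t1 /t0; case: (s); last by rewrite coprime1p.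
  by rewrite coprimep_sym coprimepX /root -polyC_natr hornerC.
have T n := chebrec_monic n st0 mt1 st1 ct1 cop.
(* The equation at the middle vertex, whose neighbours carry [t1] and [e t1]. *)
have e1 : 'X * t0 = (1 + e%:P) * t1.
  rewrite De /t0 /t1; case: (s) => /=.
    by rewrite expr0 polyC1 mulrC.
  by rewrite expr1 polyCN polyC1 subrr mul0r mulr0.
pose T_ := chebrec t0 t1.
pose f i := if (i <= c)%N then T_ (c - i)%N else e%:P * T_ (i - c)%N.
have [c' Dc] : exists c', c = c'.+1 by exists c.-1; case: (c) c0.
have [sc' mc _ _] := T c'; have [sc mc1 subc copc] := T c.
exists (T_ c.+1), (T_ c), (fun i : 'I_k => f i); split=> //.
split.
- rewrite sc; split=> //; first by rewrite Dc.
  by have [->] := T c.+1; rewrite addSn.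
- by rewrite /f pu0 leq0n subn0.
- rewrite /f pvk Dk /= -addnn leqNgt -{1}[c]addn0 ltn_add2l c0 /=.
  by rewrite addnK.
move=> i; rewrite /xsub sum_path_edge -!val_eqE /= pu0 pvk.
have Tss n : T_ n.+2 = 'X * T_ n.+1 - T_ n := chebrecSS _ _ _.
have et0 : e%:P * t0 = t0.
  by rewrite De /t0; case: (s) => /=; rewrite ?mulr0 // expr0 mul1r.
have f_le n : (n <= c)%N -> f (c - n)%N = T_ n.
  by move=> lenc; rewrite /f leq_subr subKn.
have f_ge n : f (c + n)%N = e%:P * T_ n.
  rewrite /f; case: n => [|n]; first by rewrite addn0 leqnn subnn /T_ /= et0.
  by rewrite leqNgt addnS ltnS leq_addr /= -addnS addKn.
have [ltic|ltci|eqic] := ltngtP i c.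
- have [n Dn] : exists n, c = (n.+1 + i)%N by exists (c - i).-1; lia.
  have -> : f i = T_ n.+1 by rewrite -f_le; [congr f|]; lia.
  have -> : f i.+1 = T_ n by rewrite -f_le; [congr f|]; lia.
  have -> : (i.+1 < k)%N by lia.
  have -> : (i == k.-1 :> nat) = false by apply/eqP; lia.
  rewrite mulr0 addr0; case: ltnP => lt0.
    have -> : f i.-1 = T_ n.+2 by rewrite -f_le; [congr f|]; lia.
    by rewrite gtn_eqF // mulr0 Tss; ring.
  have -> : (i == 0 :> nat) by lia.
  have -> : c.+1 = n.+2 by lia.
  by rewrite Tss polyC1; ring.
- have [n Dn] : exists n, i = (c + n.+1)%N :> nat by exists (i - c).-1; lia.
  have -> : f i = e%:P * T_ n.+1 by rewrite -f_ge; congr f; lia.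
  have -> : f i.+1 = e%:P * T_ n.+2 by rewrite -f_ge; congr f; lia.
  have -> : f i.-1 = e%:P * T_ n by rewrite -f_ge; congr f; lia.
  have -> : (i == 0 :> nat) = false by lia.
  have -> : (0 < i)%N by lia.
  rewrite add0r; case: ltnP => ltk.
    have -> : (i == k.-1 :> nat) = false by apply/eqP; lia.
    by rewrite !mulr0 Tss; ring.
  have lti := ltn_ord i; have -> : (i == k.-1 :> nat) by lia.
  have -> : c.+1 = n.+2 by lia.
  by rewrite Tss mulr1; ring.
have -> : f i = T_ 0 by rewrite -f_le; [congr f|]; lia.
have -> : f i.+1 = e%:P * T_ 1 by rewrite -f_ge; congr f; lia.
have -> : f i.-1 = T_ 1 by rewrite -f_le; [congr f|]; lia.
have -> : (0 < i)%N by lia.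
have -> : (i.+1 < k)%N by lia.
have -> : (i == 0 :> nat) = false by lia.
have -> : (i == k.-1 :> nat) = false by lia.
by rewrite mulr0 addr0 mulr0 /T_ /= e1; ring.
Qed.
End PathPencil.

(** * Gluing two pencils along a pair of vertices *)

Section GluedPencil.
Variables (K : fieldType) (V1 V2 : finType) (u1 v1 : V1) (u2 v2 : V2).
Hypotheses (neq1 : u1 != v1) (neq2 : u2 != v2).
Local Notation W := (glue_type V1 u2 v2).
Local Notation snd_of := (@glue_snd V1 V2 u1 v1 u2 v2).

(** The embedding of [V2] in the union whose partial inverse is [glue_snd]; the last branch is
    reached only by [v2]. *)
Definition glue_emb (y : V2) : W :=
  if insub y is Some b then inr b else if y == u2 then inl u1 else inl v1.

Lemma glue_embu : glue_emb u2 = inl u1.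
Proof. by rewrite /glue_emb insubF ?eqxx // !inE eqxx. Qed.

Lemma glue_embv : glue_emb v2 = inl v1.
Proof. by rewrite /glue_emb insubF ?inE ?eqxx ?orbT // eq_sym (negPf neq2). Qed.

Lemma glue_emb_sub b : glue_emb (val b) = inr b.
Proof. by rewrite /glue_emb valK. Qed.

Lemma sum_glue_snd (f : W -> V2 -> K) :
  \sum_(x : W) (if snd_of x is Some y then f x y else 0) =
  \sum_y f (glue_emb y) y.
Proof.
have vu1 : v1 != u1 by rewrite eq_sym.
rewrite big_sumType /= (bigD1 u1) //= eqxx (bigD1 v1) ?vu1 //= (negPf vu1).
rewrite eqxx big1 => [|x /andP[/negPf xu /negPf xv]]; last by rewrite xu xv.
rewrite addr0 (bigD1 u2) //= (bigD1 v2) 1?[v2 == _]eq_sym //= glue_embu glue_embv -addrA.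
congr (_ + (_ + _)).
rewrite [RHS](eq_bigl (fun y => y \notin [set u2; v2])) => [|y]; last first.
  by rewrite !inE negb_or.
rewrite [RHS](reindex_omap (val : {y | y \notin [set u2; v2]} -> V2) insub) => [|y yP].
  apply: eq_big => b; first by rewrite valK eqxx (valP b).
  by rewrite glue_emb_sub.
by rewrite insubT.
Qed.

Lemma sum_glue_fst (f : W -> V1 -> K) :
  \sum_(x : W) (if glue_fst x is Some y then f x y else 0) =
  \sum_y f (inl y) y.
Proof. by rewrite big_sumType /= big1_eq addr0. Qed.

Lemma sum_glue (f : W -> K) :
  \sum_x f x + f (inl u1) + f (inl v1) = \sum_y f (inl y) + \sum_y f (glue_emb y).
Proof.
rewrite big_sumType -!addrA; congr (_ + _).
have := sum_glue_snd (fun x _ => f x); rewrite big_sumType /= => <-.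
have vu1 : v1 != u1 by rewrite eq_sym.
rewrite (bigD1 u1) //= eqxx (bigD1 v1) ?vu1 //= (negPf vu1).
rewrite eqxx [X in (_ + (_ + X)) + _]big1 => [|x /andP[/negPf xu /negPf xv]].
  by rewrite addr0 addrC.
by rewrite xu xv.
Qed.

Variables (M1 : V1 -> V1 -> K) (M2 : V2 -> V2 -> K) (e q l : K).
Variables (a1 m1 a2 m2 : K) (w1 : V1 -> K) (w2 : V2 -> K).
Hypotheses (w1u : w1 u1 = m1) (w1v : w1 v1 = e * m1).
Hypotheses (w2u : w2 u2 = m2) (w2v : w2 v2 = e * m2).
Hypothesis w1P : forall i,
  l * w1 i - \sum_j M1 i j * w1 j = a1 * ((i == u1)%:R + e * (i == v1)%:R).
Hypothesis w2P : forall i,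
  l * w2 i - \sum_j M2 i j * w2 j = a2 * ((i == u2)%:R + e * (i == v2)%:R).

Definition glue_entry (x y : W) : K :=
  (if glue_fst x is Some a then if glue_fst y is Some b then M1 a b else 0 else 0) +
  (if snd_of x is Some a then if snd_of y is Some b then M2 a b else 0 else 0) +
  q * ((x == y) && (x \in [set inl u1; inl v1]))%:R.

(* Pair the eigenvector equation with the vector m2 w1 + m1 w2 on the glued
   vertex set; both summands agree with m1 m2 (1, e) at the glued vertices. *)
Lemma glue_eigenvector (phi : W -> K) :
  (forall y, \sum_x phi x * glue_entry x y = l * phi y) ->
  phi (inl u1) + e * phi (inl v1) != 0 ->
  m2 * a1 + m1 * a2 - l * (m1 * m2) = q * (m1 * m2).
Proof.
move=> phiP; set S := (X in X != 0) => S0.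
have sumdelta (V : finType) (u v : V) (f : V -> K) : u != v ->
    \sum_i f i * ((i == u)%:R + e * (i == v)%:R) = f u + e * f v.
  move=> uv; have vu : v != u by rewrite eq_sym.
  rewrite (bigD1 u) // (bigD1 v) ?vu //= big1.
    by rewrite !eqxx (negPf vu) (negPf uv) mulr0 !addr0 mulr1 add0r mulr1 mulrC.
  by move=> i /andP[/negPf-> /negPf->]; rewrite mulr0 addr0 mulr0.
pose w (x : W) := match x with inl a => m2 * w1 a | inr b => m1 * w2 (val b) end.
have wsnd y : w (glue_emb y) = m1 * w2 y.
  rewrite /glue_emb; case: insubP => [b _ <-|] //=.
  rewrite !inE negbK => /orP[/eqP->|/eqP->]; rewrite ?eqxx /=.
    by rewrite w1u w2u mulrC.
  by rewrite eq_sym (negPf neq2) /= w1v w2v; ring.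
(* The pairing of [phi] with the matrix applied to [w] is computed twice: here by the eigenvector
   equation, then through the three summands of the matrix in [E1], [E2] and [E3]. *)
have E : \sum_x phi x * \sum_y glue_entry x y * w y = l * \sum_y phi y * w y.
  under eq_bigr do rewrite mulr_sumr.
  rewrite exchange_big mulr_sumr; apply: eq_bigr => y _ /=.
  under eq_bigr do rewrite mulrA.
  by rewrite -mulr_suml phiP mulrA.
have E1 : \sum_x phi x * \sum_y (if glue_fst x is Some a then
    if glue_fst y is Some b then M1 a b else 0 else 0) * w y =
    m2 * (l * \sum_i phi (inl i) * w1 i - a1 * S).
  transitivity (\sum_x (if glue_fst x is Some a then
      phi x * (m2 * \sum_b M1 a b * w1 b) else 0)).
    apply: eq_bigr => x _; case: (glue_fst x) => [a|]; last first.
      by rewrite big1 ?mulr0 // => y _; rewrite mul0r.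
    congr (_ * _); rewrite mulr_sumr -(sum_glue_fst (fun y b => m2 * (M1 a b * w1 b))).
    apply: eq_bigr => -[b|b] _ /=; last by rewrite mul0r.
    by rewrite mulrCA.
  rewrite (sum_glue_fst (fun x a => phi x * (m2 * \sum_b M1 a b * w1 b))).
  rewrite /S -(sumdelta V1 u1 v1 (fun i => phi (inl i))) //.
  rewrite !mulr_sumr -sumrB mulr_sumr; apply: eq_bigr => i _.
  have -> : \sum_j M1 i j * w1 j = l * w1 i - a1 * ((i == u1)%:R + e * (i == v1)%:R).
    by rewrite -w1P subKr.
  by ring.
have E2 : \sum_x phi x * \sum_y (if snd_of x is Some a then
    if snd_of y is Some b then M2 a b else 0 else 0) * w y =
    m1 * (l * \sum_i phi (glue_emb i) * w2 i - a2 * S).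
  transitivity (\sum_x (if snd_of x is Some a then
      phi x * (m1 * \sum_b M2 a b * w2 b) else 0)).
    apply: eq_bigr => x _; case: (snd_of x) => [a|]; last first.
      by rewrite big1 ?mulr0 // => y _; rewrite mul0r.
    congr (_ * _); rewrite mulr_sumr.
    transitivity (\sum_y (if snd_of y is Some b then M2 a b * w y else 0)).
      by apply: eq_bigr => y _; case: (snd_of y) => // ; rewrite mul0r.
    rewrite (sum_glue_snd (fun y b => M2 a b * w y)).
    by apply: eq_bigr => b _; rewrite wsnd mulrCA.
  rewrite (sum_glue_snd (fun x a => phi x * (m1 * \sum_b M2 a b * w2 b))).
  rewrite /S -glue_embu -glue_embv -(sumdelta V2 u2 v2 (fun i => phi (glue_emb i))) //.
  rewrite !mulr_sumr -sumrB mulr_sumr; apply: eq_bigr => i _.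
  have -> : \sum_j M2 i j * w2 j = l * w2 i - a2 * ((i == u2)%:R + e * (i == v2)%:R).
    by rewrite -w2P subKr.
  by ring.
have E3 : \sum_x phi x * \sum_y (q * ((x == y) && (x \in [set inl u1; inl v1]))%:R)
    * w y = q * (m1 * m2 * S).
  transitivity (\sum_x phi x * (q * (x \in [set inl u1; inl v1])%:R * w x)).
    apply: eq_bigr => x _; congr (_ * _); rewrite (bigD1 x) //= eqxx.
    by rewrite big1 ?addr0 // => y; rewrite eq_sym => /negPf->; rewrite mulr0 mul0r.
  rewrite big_sumType /= [X in _ + X]big1 => [|b _]; last first.
    by rewrite !inE mulr0 mul0r mulr0.
  rewrite addr0 (bigD1 u1) // (bigD1 v1) 1?[v1 == _]eq_sym //= big1 => [|x /andP[xu xv]].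
    by rewrite !inE !eqxx orbT addr0 w1u w1v /S /=; ring.
  rewrite !inE -[inl x == inl u1]/(x == u1) -[inl x == inl v1]/(x == v1).
  by rewrite (negPf xu) (negPf xv) mulr0 mul0r mulr0.
set s1 := \sum_i phi (inl i) * w1 i in E1.
set s2 := \sum_i phi (glue_emb i) * w2 i in E2.
(* The two glued vertices are counted in both [m2 * s1] and [m1 * s2], whence the correction. *)
have Esum : \sum_x phi x * w x = m2 * s1 + m1 * s2 - m1 * m2 * S.
  have := sum_glue (fun x => phi x * w x); rewrite /= w1u w1v.
  under [X in _ = X + _]eq_bigr do rewrite mulrCA.
  under [X in _ = _ + X]eq_bigr do rewrite wsnd mulrCA.
  rewrite -!mulr_sumr -/s1 -/s2 => <-; rewrite /S; ring.
have {}E : m2 * (l * s1 - a1 * S) + m1 * (l * s2 - a2 * S) + q * (m1 * m2 * S) =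
    l * (m2 * s1 + m1 * s2 - m1 * m2 * S).
  rewrite -Esum -E -E1 -E2 -E3 -!big_split; apply: eq_bigr => x _ /=.
  rewrite -!mulrDr -!big_split; congr (_ * _); apply: eq_bigr => y _ /=.
  by rewrite -!mulrDl.
have : S * (m2 * a1 + m1 * a2 - l * (m1 * m2) - q * (m1 * m2)) = 0.
  transitivity (l * (m2 * s1 + m1 * s2 - m1 * m2 * S) -
    (m2 * (l * s1 - a1 * S) + m1 * (l * s2 - a2 * S) + q * (m1 * m2 * S))).
    by ring.
  by rewrite E subrr.
by move/eqP; rewrite mulf_eq0 (negPf S0) subr_eq0 => /eqP.
Qed.
End GluedPencil.

(** * Kronecker's theorem *)

Section AlmostPeriodicSums.
Variable R : realType.
Local Notation C := R[i].

Definition cis (x : R) : C := (cos x +i* sin x)%C.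

Lemma cisD x y : cis (x + y) = cis x * cis y.
Proof.
by rewrite /cis cosD sinD; simpc; congr (_ +i* _)%C; ring.
Qed.

Lemma cis0 : cis 0 = 1.
Proof. by rewrite /cis cos0 sin0. Qed.

Lemma cisMn x n : cis (x *+ n) = cis x ^+ n.
Proof. by elim: n => [|n IHn]; rewrite ?mulr0n ?cis0 // mulrS exprS cisD IHn. Qed.

Lemma norm_cis x : `|cis x| = 1.
Proof. by rewrite normc_def /= cos2Dsin2 sqrtr1. Qed.

Lemma cis_sum (I : finType) (x : I -> R) : cis (\sum_i x i) = \prod_i cis (x i).
Proof. by apply: (big_morph cis) => [y z|]; rewrite ?cisD ?cis0. Qed.

Lemma cis_neq1 x : x != 0 -> `|x| < 1 -> cis x != 1.
Proof.
move=> x0 x1; apply/eqP => /(congr1 (@complex.Im R)) /= sx.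
have lt_pi : `|x| < pi by apply: lt_le_trans x1 _; apply: le_trans (pi_ge2 _); rewrite ler1n.
have : 0 < sin `|x| by apply: sin_gt0_pi; rewrite normr_gt0 x0.
by have [x0'|x0'] := ler0P x; rewrite ?sinN sx ?oppr0 ltxx.
Qed.

Lemma norm_geometric_sum (z : C) n : `|z| = 1 -> z != 1 ->
  `|\sum_(i < n) z ^+ i| <= 2 / `|1 - z|.
Proof.
move=> z1 zn1; have d0 : 0 < `|1 - z| by rewrite normr_gt0 subr_eq0 eq_sym.
rewrite ler_pdivlMr // mulrC -normrM.
have -> : (1 - z) * (\sum_(i < n) z ^+ i) = 1 - z ^+ n.
  by rewrite -[1 - z]opprB mulNr -subrX1 opprB.
by apply: le_trans (ler_normB _ _) _; rewrite normrX z1 expr1n normr1.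
Qed.

Lemma archi_bound (a b : R) : (forall n : nat, a *+ n <= b) -> a <= 0.
Proof.
move=> ab; rewrite leNgt; apply/negP => a0.
have := ab (Num.bound `|b / a|); rewrite leNgt => /negP; apply.
rewrite -mulr_natl -ltr_pdivrMr //.
by apply: le_lt_trans (ler_norm _) _; exact: archi_boundP.
Qed.

Lemma bernoulli (d : R) n : 0 <= d -> 1 + d *+ n <= (1 + d) ^+ n.
Proof.
move=> d0; elim: n => [|n IHn]; first by rewrite mulr0n addr0.
rewrite exprS; apply: le_trans (ler_wpM2l _ IHn); last by rewrite addr_ge0.
rewrite mulrDl mul1r mulrDr mulr1 mulrS.
have : 0 <= d * (d *+ n) by rewrite mulr_ge0 // mulrn_wge0.
lra.
Qed.

(** Otherwise [a / b = 1 + d] with [d > 0]. At [p = m.+1 * n.+1] Bernoulli's inequality bounds the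
    left side below by a multiple of [m.+1 ^ n.+1], while the right side grows like [m.+1 ^ n]. *)
Lemma exp_poly_growth (a b : R) n : 0 <= b ->
  (forall p, a ^+ p <= (p.+1 ^ n)%:R * b ^+ p) -> a <= b.
Proof.
move=> b0 ab; rewrite leNgt; apply/negP => lt_ba.
have a0 : 0 < a by apply: le_lt_trans lt_ba.
move: b0; rewrite le_eqVlt => /orP[/eqP b0|b0].
  by have := ab 1; rewrite -b0 expr1 expr0n /= mulr0n mulr0 leNgt a0.
pose d := a / b - 1.
have d0 : 0 < d by rewrite subr_gt0 ltr_pdivlMr // mul1r.
have abd : a / b = 1 + d by rewrite addrC subrK.
have {}ab p : (1 + d) ^+ p <= (p.+1 ^ n)%:R.
  by rewrite -abd expr_div_n ler_pdivrMr ?exprn_gt0.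
suff : d ^+ n.+1 <= 0 by rewrite leNgt exprn_gt0.
apply: (@archi_bound _ ((n.+2 ^ n)%:R)) => -[|m].
  by rewrite mulr0n ler0n.
have := ab (m.+1 * n.+1)%N; rewrite exprM.
have le1 : (d *+ m.+1) ^+ n.+1 <= ((1 + d) ^+ m.+1) ^+ n.+1.
  apply: lerXn2r; rewrite ?nnegrE.
  - by rewrite mulrn_wge0 // ltW.
  - by rewrite exprn_ge0 // addr_ge0 // ltW.
  by apply: le_trans (bernoulli _ (ltW d0)); rewrite lerDr.
have le2 : ((m.+1 * n.+1).+1 ^ n)%:R <= (m.+1%:R * n.+2%:R) ^+ n :> R.
  rewrite natrX; apply: lerXn2r; rewrite ?nnegrE -?natrM ?ler0n // ler_nat.
  lia.
move/(le_trans le1)/le_trans/(_ le2).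
have -> : (d *+ m.+1) ^+ n.+1 = m.+1%:R ^+ n * (d ^+ n.+1 *+ m.+1).
  by rewrite exprMn_n -natrX mulr_natl -mulrnA expnS.
by rewrite exprMn ler_pM2l ?exprn_gt0 ?ltr0n // natrX.
Qed.
End AlmostPeriodicSums.

(** * Powers of a signed exponential sum, expanded over words in its terms *)

Section BohrKronecker.
Variables (R : realType) (J : finType) (om th : J -> R) (s : J -> bool).
Local Notation C := R[i].
Hypothesis om_ge0 : forall j, 0 <= om j.

Definition trig_sum (t : R) : C :=
  \sum_j (om j)%:C%C * (-1) ^+ s j * cis (t * th j).

Hypothesis relation_even : forall l : J -> int, (forall j, om j = 0 -> l j = 0) ->
  \sum_j l j = 0 -> \sum_j (l j)%:~R * th j = 0 -> \sum_(j | s j) l j = 0.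

Local Notation Om := (\sum_j om j).

Lemma norm_trig_sum t : `|trig_sum t| <= Om%:C%C.
Proof.
rewrite rmorph_sum; apply: le_trans (ler_norm_sum _ _ _) _.
apply: ler_sum => j _; rewrite !normrM norm_cis normrX normrN1 expr1n !mulr1.
by rewrite ger0_norm // lecR.
Qed.

Section Power.
Variable p : nat.
Local Notation word := {ffun 'I_p -> J}.
Implicit Type k : word.

Definition word_weight k : R := \prod_r om (k r).
Definition word_freq k : R := \sum_r th (k r).
Definition word_sign k : C := \prod_r (-1) ^+ s (k r).
(** The exponent vector of the monomial read off the word; each count is at most [p], so [inord]
    never falls back on its default. *)
Definition word_count k : {ffun J -> 'I_p.+1} := [ffun j => inord (\sum_r (k r == j))].

Lemma trig_sum_exp t : trig_sum t ^+ p =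
  \sum_k (word_weight k)%:C%C * word_sign k * cis (t * word_freq k).
Proof.
rewrite -[in LHS](card_ord p) -prodr_const bigA_distr_bigA.
apply: eq_bigr => k _; rewrite !big_split /= -rmorph_prod -cis_sum.
by rewrite -mulr_sumr.
Qed.

Lemma word_countE k j : word_count k j = (\sum_r (k r == j))%N :> nat.
Proof.
rewrite ffunE inordK // ltnS -[X in (_ <= X)%N](card_ord p) -sum1_card.
by apply: leq_sum => r _; case: eqP.
Qed.

Lemma sum_word_count (A : pzSemiRingType) (F : J -> A) k :
  \sum_j (word_count k j)%:R * F j = \sum_r F (k r).
Proof.
under eq_bigr do rewrite word_countE natr_sum mulr_suml.
rewrite exchange_big; apply: eq_bigr => r _ /=.
rewrite (bigD1 (k r)) //= eqxx mul1r big1 ?addr0 // => j.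
by rewrite eq_sym => /negPf->; rewrite mul0r.
Qed.

Lemma word_weight_ge0 k : 0 <= word_weight k.
Proof. by apply: prodr_ge0. Qed.

Lemma word_weight_count k j : word_weight k != 0 -> om j = 0 -> word_count k j = ord0.
Proof.
move=> kw j0; apply: ord_inj; rewrite word_countE /= big1 // => r _.
have [krj|//] := eqVneq; case/negP: kw; apply/eqP.
by rewrite /word_weight (bigD1 r) //= krj j0 mul0r.
Qed.

Lemma word_signE k : word_sign k = (-1) ^+ (\sum_(j | s j) word_count k j)%N.
Proof.
rewrite /word_sign.
have -> : (\sum_(j | s j) word_count k j)%N = (\sum_r s (k r))%N.
  have /= <- := sum_word_count (fun j => s j : nat) k.
  rewrite big_mkcond; apply: eq_bigr => j _; rewrite natn.
  by case: (s j); rewrite ?mulr1 ?mulr0.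
by rewrite expr_sum.
Qed.

(** Both words have length [p], so the difference of their counts is a relation with sum 0 between
    the frequencies; by [relation_even] the letters of negative sign are equally many in both. *)
Lemma word_sign_eq k k' : word_weight k != 0 -> word_weight k' != 0 ->
  word_freq k = word_freq k' -> word_sign k = word_sign k'.
Proof.
move=> kw kw' kf; pose l j := (word_count k j)%:Z - (word_count k' j)%:Z.
have : \sum_(j | s j) l j = 0.
  apply: relation_even => [j j0||]; rewrite /l.
  - by rewrite !word_weight_count.
  - rewrite sumrB; apply/eqP; rewrite subr_eq0; apply/eqP.
    have sumE (h : word) : \sum_j (word_count h j)%:Z = p%:Z.
      have := sum_word_count (fun=> 1 : int) h.
      rewrite sumr_const card_ord natz => <-; apply: eq_bigr => j _.
      by rewrite mulr1 natz.
    by rewrite !sumE.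
  under eq_bigr do rewrite rmorphB mulrBl.
  rewrite sumrB !(sum_word_count th); apply/eqP; rewrite subr_eq0; exact/eqP.
rewrite sumrB => /eqP; rewrite subr_eq0 => /eqP E; rewrite !word_signE.
congr (_ ^+ _); apply/eqP; rewrite -eqz_nat; apply/eqP.
by rewrite -!natz !natr_sum; under eq_bigr do rewrite natz;
   under [RHS]eq_bigr do rewrite natz.
Qed.

(** Pigeonhole: the total weight [Om ^+ p] is spread over at most [(p.+1) ^ #|J|] count vectors, and
    words with equal counts have equal frequency. *)
Lemma word_class : 0 < Om -> exists k0, word_weight k0 != 0 /\
  Om ^+ p <= (p.+1 ^ #|J|)%:R * \sum_(k | word_freq k == word_freq k0) word_weight k.
Proof.
move=> Om0; pose N v := \sum_(k | word_count k == v) word_weight k.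
have sumN : Om ^+ p = \sum_v N v.
  rewrite -[in LHS](card_ord p) -prodr_const bigA_distr_bigA.
  by rewrite (partition_big word_count xpredT).
have cardv : #|{ffun J -> 'I_p.+1}| = (p.+1 ^ #|J|)%N by rewrite card_ffun card_ord.
have [v Nv] : exists v, Om ^+ p <= (p.+1 ^ #|J|)%:R * N v.
  apply/existsP; apply: contraT; rewrite negb_exists => /forallP ltN.
  have : \sum_(v : {ffun J -> 'I_p.+1}) (p.+1 ^ #|J|)%:R * N v <
      \sum_(v : {ffun J -> 'I_p.+1}) Om ^+ p.
    apply: ltr_sum => [|v _]; last by rewrite ltNge.
    by apply/hasP; exists [ffun=> ord0]; rewrite ?mem_index_enum.
  by rewrite -mulr_sumr -sumN sumr_const cardv -[in ltRHS]mulr_natl ltxx.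
have Nv_neq0 : N v != 0.
  apply: contraTneq Nv => ->; rewrite mulr0 -ltNge; exact: exprn_gt0.
have [k0 /andP[/eqP k0v k0w]] : exists k0, (word_count k0 == v) && (word_weight k0 != 0).
  apply/existsP; apply: contraNT Nv_neq0; rewrite negb_exists => /forallP kN.
  by rewrite /N big1 // => k kv; have := kN k; rewrite kv /= negbK => /eqP.
exists k0; split=> //; apply: le_trans Nv _; rewrite ler_wpM2l ?ler0n //.
rewrite /N big_mkcond [leRHS]big_mkcond; apply: ler_sum => k _.
have [kv|_] := eqVneq; last by case: ifP => // _; apply: word_weight_ge0.
suff -> : word_freq k = word_freq k0 by rewrite eqxx.
by rewrite /word_freq -!(sum_word_count th) kv k0v.
Qed.

(* Averaging [trig_sum ^ p], rotated by the frequency of [k0], over an arithmetic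
   progression of times only leaves the words with that frequency. *)
Lemma trig_sum_class_le k0 (T q : R) : word_weight k0 != 0 ->
  (forall t, T < t -> `|trig_sum t| <= q%:C%C) ->
  \sum_(k | word_freq k == word_freq k0) word_weight k <= q ^+ p.
Proof.
move=> k0w trig_le; set N := \sum_(k | _) _.
pose x k := word_freq k - word_freq k0.
(* So small a step that [tau * x k] has absolute value below 1, and [cis (tau * x k) != 1] for every
   nonzero [x k]. *)
pose tau : R := (1 + \sum_k `|x k|)^-1.
have den0 : 0 < 1 + \sum_k `|x k| by rewrite ltr_wpDr // sumr_ge0.
have tau0 : 0 < tau by rewrite invr_gt0.
have cis_tau k : x k != 0 -> cis (tau * x k) != 1.
  move=> xk; apply: cis_neq1; first by rewrite mulf_neq0 // gt_eqF.
  rewrite normrM gtr0_norm // mulrC -ltr_pdivlMr ?invrK // mul1r.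
  by rewrite (bigD1 k) //= addrCA ltrDl ltr_wpDr // sumr_ge0.
pose c k : C := (word_weight k)%:C%C * word_sign k * word_sign k0.
pose g t := word_sign k0 * cis (- (t * word_freq k0)) * trig_sum t ^+ p.
have gE t : g t = \sum_k c k * cis (t * x k).
  rewrite /g trig_sum_exp mulr_sumr; apply: eq_bigr => k _.
  by rewrite /c /x mulrBr cisD; ring.
have sgn1 k : `|word_sign k| = 1.
  by rewrite /word_sign normr_prod big1 // => r _; rewrite normrX normrN1 expr1n.
have sgn2 k : word_sign k * word_sign k = 1.
  by rewrite word_signE -exprD addnn -mul2n exprM sqrrN !expr1n.
have normc_c k : `|c k| = (word_weight k)%:C%C.
  by rewrite /c !normrM !sgn1 !mulr1 ger0_norm // lecR word_weight_ge0.
(* Bounds the geometric sums of all the other frequencies uniformly in their length [n], so that it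
   disappears on average. *)
pose B := \sum_(k | x k != 0) `|c k| * (2 / `|1 - cis (tau * x k)|).
have main n : N%:C%C *+ n - B <= (q ^+ p)%:C%C *+ n.
  pose S := \sum_(m < n) g (T + tau *+ m.+1).
  have normS : `|S| <= (q ^+ p)%:C%C *+ n.
    apply: le_trans (ler_norm_sum _ _ _) _.
    rewrite -[n in _ *+ n](card_ord n) -sumr_const; apply: ler_sum => m _.
    rewrite /g !normrM sgn1 norm_cis !mul1r normrX rmorphXn /=.
    apply: lerXn2r; rewrite ?nnegrE //; last first.
      by apply: trig_le; rewrite ltrDl pmulrn_lgt0.
    apply: le_trans (trig_le (T + 1) _); rewrite ?normr_ge0 // ltrDl; exact: ltr01.
  apply: le_trans normS; have DS : S = N%:C%C *+ n +
      \sum_(k | x k != 0) c k * cis ((T + tau) * x k) * \sum_(m < n) cis (tau * x k) ^+ m.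
    rewrite /S; under eq_bigr do rewrite gE.
    rewrite exchange_big (bigID (fun k => x k == 0)) /=; congr (_ + _).
      rewrite /N rmorph_sum -sumrMnl; apply: eq_big => [k|k /eqP xk].
        by rewrite subr_eq0.
      rewrite xk; under eq_bigr do rewrite mulr0 cis0 mulr1.
      rewrite sumr_const card_ord; congr (_ *+ _); rewrite /c.
      (* Words of nonzero weight at this frequency share the sign of [k0]: they add up without
         cancellation. *)
      have [->|kw] := eqVneq (word_weight k) 0; first by rewrite !mul0r.
      rewrite (word_sign_eq kw k0w) ?sgn2 -?mulrA ?sgn2 ?mulr1 //.
      by apply/eqP; rewrite -subr_eq0 -/(x k) xk.
    apply: eq_bigr => k _; rewrite mulr_sumr; apply: eq_bigr => m _.
    rewrite -mulrA -cisMn -cisD; congr (_ * cis _).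
    by rewrite mulrS !mulrDl -mulrnAl; ring.
  rewrite DS; set E := \sum_(k | _) _.
  have E_le : `|E| <= B.
    apply: le_trans (ler_norm_sum _ _ _) _; apply: ler_sum => k xk.
    rewrite normrM normrM norm_cis mulr1 ler_wpM2l //.
    by apply: norm_geometric_sum; rewrite ?norm_cis ?cis_tau.
  have N_norm : `|N%:C%C *+ n| = N%:C%C *+ n.
    by rewrite ger0_norm // mulrn_wge0 // lecR sumr_ge0 // => k _; apply: word_weight_ge0.
  rewrite -[X in X - _]N_norm lerBlDr.
  rewrite -{1}[N%:C%C *+ n](addrK E); apply: le_trans (ler_normB _ _) _.
  by rewrite lerD2l.
have B_real : B = (complex.Re B)%:C%C.
  by rewrite RRe_real // ger0_real // sumr_ge0 // => k _; rewrite mulr_ge0 // divr_ge0.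
rewrite -subr_le0; apply: (@archi_bound _ _ (complex.Re B)) => n.
have := main n; rewrite B_real -!rmorphMn -rmorphB lecR mulrnBl; lra.
Qed.
End Power.

(* If [trig_sum] stayed below q < Om then Om ^ p <= (p + 1) ^ #|J| q ^ p for all p. *)
Theorem trig_sum_sup (T q : R) : q < Om ->
  exists2 t, T < t & ~~ (`|trig_sum t| <= q%:C%C).
Proof.
move=> ltq; apply: contrapT => noT.
have trig_le t : T < t -> `|trig_sum t| <= q%:C%C.
  by move=> ltT; apply: contrapT => /negP nle; apply: noT; exists t.
have q0 : 0 <= q.
  by rewrite -(lecR 0); apply: le_trans (trig_le (T + 1) _); rewrite ?normr_ge0 ?ltrDl.
suff : Om <= q by rewrite leNgt ltq.
apply: (exp_poly_growth (n := #|J|) q0) => p.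
have [k0 [k0w]] := word_class p (le_lt_trans q0 ltq).
move/le_trans; apply; rewrite ler_wpM2l ?ler0n //.
exact: trig_sum_class_le trig_le.
Qed.
End BohrKronecker.

(** * The exponential of a real symmetric matrix *)

Section MatrixExponential.
Local Open Scope classical_set_scope.
Variable K : numFieldType.

Lemma diagonalized_exp n (P : 'M[K]_n) (d : 'rV[K]_n) m : P \in unitmx ->
  (invmx P *m diag_mx d *m P) ^+ m =
  invmx P *m diag_mx (map_mx (fun z => z ^+ m) d) *m P.
Proof.
move=> uP; elim: m => [|m IHm].
  have -> : map_mx (fun z : K => z ^+ 0) d = const_mx 1.
    by apply/rowP => j; rewrite !mxE.
  by rewrite diag_const_mx mulmx1 mulVmx.
rewrite exprS IHm -[LHS]/(_ *m _) !mulmxA mulmxK //.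
rewrite -[_ *m diag_mx d *m _]mulmxA mulmx_diag; congr (_ *m diag_mx _ *m _).
by apply/rowP => j; rewrite !mxE exprS.
Qed.

Lemma diagonalized_entry n (P : 'M[K]_n) (d : 'rV[K]_n) a b :
  (invmx P *m diag_mx d *m P) a b = \sum_j invmx P a j * P j b * d 0 j.
Proof. by rewrite mul_mx_diag mxE; apply: eq_bigr => j _; rewrite mxE mulrAC. Qed.

(** Matrix convergence is entrywise, and each entry of a partial sum is a fixed linear combination
    of the scalar partial sums at the diagonal entries. *)
Lemma expmx_diagonalized n (P : 'M[K]_n) (d e : 'rV[K]_n) : P \in unitmx ->
  (forall j (eps : K), 0 < eps -> exists N0, forall N, (N0 <= N)%N ->
     `|e 0 j - \sum_(0 <= m < N) (m`!%:R)^-1 * d 0 j ^+ m| < eps) ->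
  expmx (invmx P *m diag_mx d *m P) = invmx P *m diag_mx e *m P.
Proof.
move=> uP cvg_e; apply/cvg_lim; first exact: norm_hausdorff.
set A := invmx P *m diag_mx d *m P; set L := invmx P *m diag_mx e *m P.
have cvgL a b : (fun N => series (fun m => (m`!%:R)^-1 *: A ^+ m) N a b) @ \oo --> L a b.
  have -> : (fun N => series (fun m => (m`!%:R)^-1 *: A ^+ m) N a b) =
    (fun N => \sum_j invmx P a j * P j b *
       \sum_(0 <= m < N) (m`!%:R)^-1 * d 0 j ^+ m).
    apply/funext => N; rewrite /series /= summxE.
    under [RHS]eq_bigr do rewrite mulr_sumr.
    rewrite exchange_big; apply: eq_bigr => m _ /=.
    rewrite mxE diagonalized_exp // diagonalized_entry mulr_sumr.
    by apply: eq_bigr => j _; rewrite !mxE mulrCA.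
  rewrite /L diagonalized_entry; apply: cvg_big => //.
    exact: add_continuous.
  move=> j _; apply: cvgMl_tmp.
  apply/cvgrPdist_lt => eps /(cvg_e j)[N0 N0P].
  by exists N0 => // N /=; apply: N0P.
move=> B [Q LQ QB].
have : \forall N \near \oo, forall ij : 'I_n * 'I_n,
    Q ij.1 ij.2 (series (fun m => (m`!%:R)^-1 *: A ^+ m) N ij.1 ij.2).
  by apply: filter_forall => -[a b]; apply: cvgL; apply: LQ.
by apply: filterS => N QN; apply: QB => a b; apply: (QN (a, b)).
Qed.
End MatrixExponential.

Section ComplexExponential.
Local Open Scope classical_set_scope.
Variable R : realType.
Local Notation C := R[i].

Lemma exp_coeff_cis (x : R) m :
  (m`!%:R)^-1 * ('i * x%:C)%C ^+ m = (cos_coeff x m +i* sin_coeff x m)%C :> C.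
Proof.
have -> : (m`!%:R : C) = (m`!%:R : R)%:C%C by rewrite rmorph_nat.
rewrite -fmorphV /= exprMn -rmorphXn /= /cos_coeff /sin_coeff /=.
have -> : ('i%C : C) ^+ m =
    ((~~ odd m)%:R * (-1) ^+ m./2 +i* ((odd m)%:R * (-1) ^+ m.-1./2))%C.
  rewrite -[X in _ ^+ X]odd_double_half exprD -mul2n exprM sqr_i.
  have -> : (-1 : C) ^+ m./2 = ((-1) ^+ m./2)%:C%C by rewrite rmorphXn rmorphN rmorph1.
  case: (boolP (odd m)) => om; rewrite ?expr1 ?expr0; simpc => //.
  suff -> : m.-1./2 = m./2 by [].
  by rewrite -[in LHS](odd_double_half m) om /= doubleK.
by simpc; congr (_ +i* _)%C; rewrite mulrC.
Qed.

(** The real and imaginary parts are the cosine and sine series, each approximated within half of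
    [eps], which is real because it is positive. *)
Lemma exp_cis_cvg (x : R) (eps : C) : 0 < eps -> exists N0, forall N, (N0 <= N)%N ->
  `|cis x - \sum_(0 <= m < N) (m`!%:R)^-1 * ('i * x%:C)%C ^+ m| < eps.
Proof.
move=> e0; have eE : eps = (complex.Re eps)%:C%C by rewrite RRe_real // gtr0_real.
have e2 : 0 < complex.Re eps / 2 by rewrite divr_gt0 // -(ltcR 0) -eE.
have cosc : series (cos_coeff x) @ \oo --> cos x.
  by rewrite unlock; apply: is_cvg_series_cos_coeff.
have sinc : series (sin_coeff x) @ \oo --> sin x.
  by rewrite unlock; apply: is_cvg_series_sin_coeff.
have [N1 _ N1P] := proj1 (cvgrPdist_lt _ _) cosc _ e2.
have [N2 _ N2P] := proj1 (cvgrPdist_lt _ _) sinc _ e2.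
exists (maxn N1 N2) => N; rewrite geq_max => /andP[/N1P ltc /N2P lts].
have -> : \sum_(0 <= m < N) (m`!%:R)^-1 * ('i * x%:C)%C ^+ m =
    (series (cos_coeff x) N +i* series (sin_coeff x) N)%C :> C.
  rewrite /series /=; elim: N {ltc lts} => [|N IHN]; first by rewrite !big_geq.
  by rewrite !big_nat_recr //= IHN exp_coeff_cis; simpc.
rewrite /cis; move: (series (cos_coeff x) N) (series (sin_coeff x) N) ltc lts.
move=> a b /= ltc lts.
have -> : (cos x +i* sin x)%C - (a +i* b)%C =
    (cos x - a)%:C%C + 'i%C * (sin x - b)%:C%C :> C.
  by simpc.
apply: le_lt_trans (ler_normD _ _) _; rewrite normrM.
have -> : `|'i%C : C| = 1 by rewrite normc_def /= expr0n expr1n add0r sqrtr1.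
rewrite mul1r !normc_def /= expr0n !addr0 !sqrtr_sqr -rmorphD eE ltcR.
by rewrite [ltRHS]splitr; apply: ltrD.
Qed.
End ComplexExponential.

(** * The transition amplitude as a signed exponential sum *)

Section SpectralTransfer.
Variable R : realType.
Local Notation C := R[i].

Lemma real_symmetric_normal n (N : 'M[R]_n) : N^T = N ->
  map_mx (real_complex R) N \is hermsymmx.
Proof.
move=> NT; apply/is_hermitianmxP; rewrite expr0 scale1r.
apply/matrixP => i j; rewrite !mxE -[in LHS]NT mxE conj_Creal //.
by rewrite realE !lecR -realE num_real.
Qed.

(** An index pairs a sign with an eigenvector number. The formula is the polarization identity: the
    squared moduli of [a + b] and [a - b] differ by twice the sum of [a^* b] and its conjugate. *)
Lemma transfer_trig_sum (V : finType) (N : 'M[R]_#|V|) (u v : V) : N^T = N ->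
  exists om th : bool * 'I_#|V| -> R,
  [/\ forall j, 0 <= om j, \sum_j om j = 4,
      forall t, 4 * (transfer N u v t)%:C%C = `|trig_sum om th fst t| &
      forall j, om j != 0 -> exists2 phi : V -> C,
        phi u + (-1) ^+ j.1 * phi v != 0 &
        forall y, \sum_x phi x * (entry N x y)%:C%C = (th j)%:C%C * phi y].
Proof.
move=> NT; set Nc := map_mx (real_complex R) N.
have hermN := real_symmetric_normal NT.
pose P := spectralmx Nc; pose x j := complex.Re (spectral_diag Nc 0 j).
have uP : P \in unitmx by apply: spectral_unit.
have PU : P \is unitarymx by apply: spectral_unitarymx.
have dE : spectral_diag Nc = \row_j (x j)%:C%C.
  apply/rowP => j; rewrite mxE RRe_real //.
  by have /mxOverP := hermitian_spectral_diag_real hermN.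
have NE : Nc = invmx P *m diag_mx (\row_j (x j)%:C%C) *m P.
  by rewrite -dE; apply/orthomx_spectralP/hermitian_normalmx.
have invP i j : invmx P i j = (P j i)^*%C by rewrite (invmx_unitary PU) !mxE.
pose a j : C := P j (enum_rank u); pose b j : C := P j (enum_rank v).
pose f (bj : bool * 'I_#|V|) : C := a bj.2 + (-1) ^+ bj.1 * b bj.2.
pose om bj := complex.Re (`|f bj| ^+ 2); pose th (bj : bool * 'I_#|V|) := x bj.2.
have omE bj : (om bj)%:C%C = `|f bj| ^+ 2 by rewrite RRe_real // ger0_real // exprn_ge0.
have sum_pair (F : bool * 'I_#|V| -> C) :
    \sum_bj F bj = \sum_j (F (true, j) + F (false, j)).
  rewrite (eq_bigr (fun p => F (p.1, p.2))) => [|[c j] _ //].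
  by rewrite -(pair_bigA _ (fun c j => F (c, j))) /= big_bool big_split.
exists om, th; split.
- by move=> bj; rewrite -(lecR 0) omE exprn_ge0.
(* Columns of a unitary matrix have length 1; the parallelogram law then makes the total weight
   4. *)
- have norm1 w : \sum_j `|P j (enum_rank w)| ^+ 2 = 1.
    have /matrixP/(_ (enum_rank w) (enum_rank w)) := mulVmx uP.
    rewrite !mxE eqxx => Ew; apply: etrans Ew; apply: eq_bigr => j _.
    by rewrite invP normCK mulrC.
  apply: (fmorph_inj (real_complex R)); rewrite rmorph_sum rmorph_nat /=.
  under eq_bigr do rewrite omE.
  rewrite sum_pair.
  have -> : \sum_j (`|f (true, j)| ^+ 2 + `|f (false, j)| ^+ 2) =
      \sum_j (2 * `|a j| ^+ 2 + 2 * `|b j| ^+ 2).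
    apply: eq_bigr => j _; rewrite /f /= expr1 expr0 !normCK mulN1r mul1r.
    by rewrite rmorphB rmorphD /=; ring.
  rewrite big_split /= -!mulr_sumr !norm1; ring.
- move=> t; pose e := \row_j cis (t * x j).
  have AE : ('i * t%:C)%C *: Nc =
      invmx P *m diag_mx (\row_j ('i * (t * x j)%:C)%C) *m P.
    have -> : (\row_j ('i * (t * x j)%:C)%C) = ('i * t%:C)%C *: \row_j (x j)%:C%C.
      by apply/rowP => j; rewrite !mxE rmorphM mulrA.
    by rewrite linearZ -scalemxAr -scalemxAl -NE.
  have cvg_e j (eps : C) : 0 < eps -> exists N0, forall m, (N0 <= m)%N ->
     `|e 0 j - \sum_(0 <= i < m)
        (i`!%:R)^-1 * (\row_j ('i * (t * x j)%:C)%C) 0 j ^+ i| < eps.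
    by move=> /(exp_cis_cvg (t * x j))[N0 N0P]; exists N0 => m /N0P; rewrite !mxE.
  have expA := expmx_diagonalized uP cvg_e; rewrite -AE in expA.
  (* [N] is symmetric, so the exponential is its own transpose; this yields a second expansion of
     the entry with [a] and [b] exchanged, and polarization uses both. *)
  have expAT : expmx (('i * t%:C)%C *: Nc) = (invmx P *m diag_mx e *m P)^T.
    have uP2 : invmx P^T \in unitmx by rewrite unitmx_inv unitmx_tr.
    have := expmx_diagonalized uP2 cvg_e; rewrite invmxK.
    rewrite !trmx_mul tr_diag_mx trmx_inv mulmxA => <-.
    congr expmx; rewrite -[LHS]trmxK.
    have -> : (('i * t%:C)%C *: Nc)^T = ('i * t%:C)%C *: Nc.
      by rewrite linearZ /= /Nc map_trmx NT.
    by rewrite AE !trmx_mul tr_diag_mx trmx_inv mulmxA.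
  have entry1 : entry (expmx (('i * t%:C)%C *: Nc)) u v =
      \sum_j (a j)^*%C * b j * cis (t * x j).
    rewrite expA /entry diagonalized_entry; apply: eq_bigr => j _.
    by rewrite invP mxE.
  have entry2 : entry (expmx (('i * t%:C)%C *: Nc)) u v =
      \sum_j (b j)^*%C * a j * cis (t * x j).
    rewrite expAT /entry mxE diagonalized_entry; apply: eq_bigr => j _.
    by rewrite invP mxE.
  have -> : (transfer N u v t)%:C%C = `|entry (expmx (('i * t%:C)%C *: Nc)) u v|.
    by rewrite /transfer -/Nc; case: (entry _ _ _) => p q; rewrite normc_def.
  rewrite -[4 in LHS]normr_nat -normrM; congr `|_|.
  have -> : 4 * entry (expmx (('i * t%:C)%C *: Nc)) u v =
      2 * (\sum_j (a j)^*%C * b j * cis (t * x j)) +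
      2 * (\sum_j (b j)^*%C * a j * cis (t * x j)).
    rewrite -entry1 -entry2; ring.
  rewrite /trig_sum sum_pair !mulr_sumr -big_split; apply: eq_bigr => j _ /=.
  rewrite !omE /f /th /= expr1 expr0 !normCK mulN1r mul1r.
  by rewrite rmorphB rmorphD /=; ring.
move=> bj om0; exists (fun y => P bj.2 (enum_rank y)).
  apply: contraNneq om0 => f0; apply/eqP/(fmorph_inj (real_complex R)).
  by rewrite /= omE /f /a /b f0 normr0 expr0n rmorph0.
move=> y; have : P *m Nc = diag_mx (\row_j (x j)%:C%C) *m P.
  by rewrite {1}NE !mulmxA mulmxV // mul1mx.
move=> /matrixP/(_ bj.2 (enum_rank y)); rewrite mul_diag_mx !mxE => <-.
rewrite [RHS](reindex (enum_rank : V -> 'I_#|V|)) /=; last first.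
  by apply: onW_bij; exists enum_val; [apply: enum_rankK | apply: enum_valK].
by apply: eq_bigr => z _; rewrite mxE.
Qed.
End SpectralTransfer.

(** * The glued graph *)

Section GluedPencilPolynomials.
Variables a1 m1 a2 m2 : {poly rat}.
Hypotheses (ma1 : a1 \is monic) (mm1 : m1 \is monic).
Hypotheses (ma2 : a2 \is monic) (mm2 : m2 \is monic).
Hypotheses (sa1 : size a1 = (size m1).+1) (sa2 : size a2 = (size m2).+1).
Hypotheses (cop1 : coprimep a1 m1) (cop2 : coprimep a2 m2) (cop12 : coprimep m1 m2).

Local Notation A := (m2 * a1 + m1 * a2 - 'X * (m1 * m2)).
Local Notation B := (m1 * m2).

(** [A / B] is [a1 / m1 + a2 / m2 - 'X]: the two Schur complements count ['X] twice at the glued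
    vertices. Coprimality holds because [A] is [m2 * a1] modulo [m1] and [m1 * a2] modulo [m2]. *)
Lemma glued_numer_spec :
  [/\ A \is monic, B \is monic, size A = (size B).+1, coprimep A B &
      subcoef A = subcoef a1 + subcoef a2].
Proof.
have mB : B \is monic by rewrite monicMl.
have m1_0 : (0 < size m1)%N by rewrite size_poly_gt0 monic_neq0.
have m2_0 : (0 < size m2)%N by rewrite size_poly_gt0 monic_neq0.
have [n sB] : exists n, size B = n.+1.
  by exists (size B).-1; rewrite prednK // size_poly_gt0 monic_neq0.
have sM : (size m1 + size m2)%N = n.+2.
  have := sB; rewrite size_Mmonic ?monic_neq0 //.
  by set x := size m1; set y := size m2; lia.
pose p1 : {poly rat} := m2 * a1; pose p2 : {poly rat} := m1 * a2.
pose p3 : {poly rat} := 'X * B.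
have mp1 : p1 \is monic by rewrite monicMl.
have mp2 : p2 \is monic by rewrite monicMl.
have mp3 : p3 \is monic by rewrite monicMl ?monicX.
have s1 : size p1 = n.+2.
  rewrite size_Mmonic ?monic_neq0 // sa1 addnS /= -sM; exact: addnC.
have s2 : size p2 = n.+2 by rewrite size_Mmonic ?monic_neq0 // sa2 addnS.
have s3 : size p3 = n.+2 by rewrite /p3 mulrC size_mulX ?monic_neq0 // sB.
have s23 : (size (p2 - p3)%R < size p1)%N.
  rewrite s1 ltnS; apply/leq_sizeP => j; rewrite leq_eqVlt coefB => /orP[/eqP <-|ltj].
    have := monicP mp2; rewrite lead_coefE s2 /= => ->.
    by have := monicP mp3; rewrite lead_coefE s3 /= => ->; rewrite subrr.
  by rewrite !nth_default ?s2 ?s3 // subrr.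
have DA : A = p1 + (p2 - p3) by rewrite addrA.
have sA : size A = n.+2 by rewrite DA size_polyDl.
split=> //.
- by rewrite monicE DA lead_coefDl // -monicE.
- by rewrite sA sB.
- rewrite coprimepMr; apply/andP; split; rewrite coprimep_sym.
    have -> : A = (a2 - 'X * m2) * m1 + m2 * a1 by ring.
    by rewrite coprimep_addl_mul coprimepMr cop12 coprimep_sym.
  have -> : A = (a1 - 'X * m1) * m2 + m1 * a2 by ring.
  by rewrite coprimep_addl_mul coprimepMr coprimep_sym cop12 coprimep_sym.
rewrite (subcoefE sA) DA !coefD coefN -(subcoefE s1) -(subcoefE s2) -(subcoefE s3).
rewrite !subcoefM ?monicX // (@subcoefE _ 'X 0) ?size_polyX // coefX add0r.
ring.
Qed.
End GluedPencilPolynomials.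

Lemma avoid_finite (K : numDomainType) (s : seq K) : exists c : nat, c%:R \notin s.
Proof.
apply: contrapT => H; have all_s c : c%:R \in s.
  by apply: contrapT => /negP ns; apply: H; exists c.
have := @uniq_leq_size _ [seq (i%:R : K) | i <- iota 0 (size s).+1] s.
rewrite map_inj_uniq ?iota_uniq; last by move=> i j /eqP; rewrite eqr_nat => /eqP.
rewrite size_map size_iota ltnn => /(_ isT) le_s.
by have /le_s : {subset [seq (i%:R : K) | i <- iota 0 (size s).+1] <= s}
  by move=> x /mapP[i _ ->].
Qed.

(** Only the finitely many differences of a root of [p1] and a root of [p2], together with [r], must
    be avoided. *)
Lemma generic_shift (K : numClosedFieldType) (p1 p2 : {poly K}) (r : K) :
  p1 != 0 -> p2 != 0 ->
  exists c : nat, c%:R != r /\ forall z, root p1 z -> ~~ root p2 (z - c%:R).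
Proof.
move=> p10 p20; have [s1 D1] := closed_field_poly_normal p1.
have [s2 D2] := closed_field_poly_normal p2.
have [c] := avoid_finite (r :: [seq z1 - z2 | z1 <- s1, z2 <- s2]).
rewrite inE negb_or => /andP[cr cs]; exists c; split=> // z.
rewrite D1 rootZ ?lead_coef_eq0 // root_prod_XsubC => z1.
apply: contra cs; rewrite D2 rootZ ?lead_coef_eq0 // root_prod_XsubC => z2.
by apply/allpairsP; exists (z, z - c%:R); rewrite /= subKr.
Qed.

Lemma entry_fmx (T : Type) (V : finType) (F : V -> V -> T) x y :
  entry (fmx F) x y = F x y.
Proof. by rewrite /entry mxE !enum_rankK. Qed.

Lemma mxglue_entry (R : realType) (V1 V2 : finType) (u1 v1 : V1) (u2 v2 : V2)
    (A1 : V1 -> V1 -> R) (A2 : V2 -> V2 -> R) (q : R) (x y : glue_type V1 u2 v2) :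
  (entry (mxglue u1 v1 u2 v2 (fmx A1) (fmx A2) + q *: Dmx R (inl u1) (inl v1)) x y)%:C%C =
  glue_entry u1 v1 (fun a b => (A1 a b)%:C%C) (fun a b => (A2 a b)%:C%C) q%:C%C x y.
Proof.
have -> : entry (mxglue u1 v1 u2 v2 (fmx A1) (fmx A2) + q *: Dmx R (inl u1) (inl v1)) x y =
    entry (extend0 (@glue_fst V1 V2 u2 v2) (fmx A1)) x y +
    entry (extend0 (@glue_snd V1 V2 u1 v1 u2 v2) (fmx A2)) x y +
    q * entry (Dmx R (inl u1) (inl v1)) x y by rewrite /entry !mxE.
rewrite !entry_fmx !rmorphD rmorphM rmorph_nat /glue_entry; congr (_ + _ + _).
  by case: (glue_fst x) => [a|] //; case: (glue_fst y) => [b|] //; rewrite entry_fmx.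
by case: (glue_snd _ _ x) => [a|] //; case: (glue_snd _ _ y) => [b|] //; rewrite entry_fmx.
Qed.

Lemma pencil_data_eval (K : numFieldType) (V : finType) (M : V -> V -> rat)
    u v e a m w (l : K) :
  pencil_data M u v e a m w -> forall i,
  l * (map_poly ratr (w i)).[l] - \sum_j ratr (M i j) * (map_poly ratr (w j)).[l] =
  (map_poly ratr a).[l] * ((i == u)%:R + ratr e * (i == v)%:R).
Proof.
case=> _ _ _ wP i; have := congr1 (fun p => (map_poly (ratr : rat -> K) p).[l]) (wP i).
rewrite /xsub rmorphB !rmorphM /= map_polyX map_polyC rmorph_sum hornerD hornerN !hornerM.
rewrite hornerX hornerC horner_sum /= rmorphD rmorphM /= !rmorph_nat => <-; congr (_ - _).
by apply: eq_bigr => j _; rewrite map_polyZ hornerZ.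
Qed.

(** The total weight 4 bounds the amplitude by 1, and [trig_sum_sup] finds amplitudes close to 1
    beyond any time. *)
Lemma PGST_trig_sum (R : realType) (V : finType) (N : 'M[R]_#|V|) (u v : V)
    (J : finType) (om th : J -> R) (s : J -> bool) :
  (forall j, 0 <= om j) -> \sum_j om j = 4 ->
  (forall l : J -> int, (forall j, om j = 0 -> l j = 0) ->
     \sum_j l j = 0 -> \sum_j (l j)%:~R * th j = 0 -> \sum_(j | s j) l j = 0) ->
  (forall t, 4 * (transfer N u v t)%:C%C = `|trig_sum om th s t|) ->
  PGST N u v.
Proof.
move=> om0 om4 rel transE.
have tr_le1 t : transfer N u v t <= 1.
  have := norm_trig_sum th s om0 t; rewrite om4 -transE.
  have -> : (4 : R)%:C%C = 4 :> R[i] by rewrite rmorph_nat.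
  by rewrite -{2}[4]mulr1 ler_pM2l ?ltr0n // -[1]/(1%:C)%C lecR.
have tr_gt (T e : R) : 0 < e -> exists2 t, T < t & 1 - e < transfer N u v t.
  move=> e0; have [|t Tt] := trig_sum_sup om0 rel T (q := 4 * (1 - e)).
    by rewrite om4; lra.
  rewrite -transE => nle; exists t => //; rewrite ltNge; apply: contra nle.
  rewrite [(4 * (1 - e))%:C%C]rmorphM rmorph_nat => le.
  by rewrite ler_pM2l ?ltr0n // lecR.
rewrite /PGST limf_esupE; apply/eqP; rewrite eq_le; apply/andP; split.
  apply: ge_ereal_inf; exists (ereal_sup [set (transfer N u v t)%:E | t in setT]).
    by exists setT => //; apply: filterT.
  by apply: ge_ereal_sup => _ [t _ <-]; rewrite lee_fin.
apply: le_ereal_inf_tmp => _ [V0 [T [_ V0T]] <-]; apply/lee_addgt0Pr => e e0.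
have [t Tt lt_t] := tr_gt T e e0.
rewrite -leeBlDr // -EFinB; apply: le_ereal_sup_tmp.
by exists (transfer N u v t)%:E; [exists t => //; apply: V0T | rewrite lee_fin ltW].
Qed.

(** * Integer relations between eigenvalues of the two signs *)

Section TraceObstruction.
Variables (K : numClosedFieldType) (q : K).
Hypothesis q_transc : ~ algebraicOver (ratr : rat -> K) q.
Local Notation "p ^@" := (map_poly (ratr : rat -> K) p) (at level 2, format "p ^@").

(** Equality would be a linear equation for [q] over the rationals: it makes [q] rational if [n0]
    and [n1] differ, and [r1 = r0] if they agree. *)
Lemma transc_mean_neq (r0 r1 : rat) (n0 n1 : nat) : (0 < n0)%N -> (0 < n1)%N ->
  (n1 = n0 -> r1 != r0) -> (q - ratr r1) / n1%:R != (q - ratr r0) / n0%:R.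
Proof.
move=> n0_gt0 n1_gt0 r01; apply/eqP => /eqP.
rewrite eqr_div ?pnatr_eq0 -?lt0n // => /eqP E.
have [n01|n01] := eqVneq n1 n0.
  have /eqP := E; rewrite n01 (inj_eq (mulIf _)) ?pnatr_eq0 -?lt0n //.
  by rewrite (inj_eq (addrI _)) eqr_opp fmorph_eq /= (negPf (r01 n01)).
apply: q_transc; have d0 : n0%:R - n1%:R != 0 :> K.
  by rewrite subr_eq0 eqr_nat eq_sym.
have -> : q = ratr (r1 * n0%:R - r0 * n1%:R) / ratr (n0%:R - n1%:R).
  rewrite !rmorphB !rmorphM !rmorph_nat; apply: (mulIf d0); rewrite mulfVK //.
  move: E; rewrite !mulrBl => /eqP; rewrite subr_eq addrAC -subr_eq => /eqP E.
  rewrite mulrBr; move/eqP: E; rewrite subr_eq => /eqP ->; ring.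
by apply: algebraic_div; apply: algebraic_id.
Qed.

(** The normalized trace of the relation reads [L * (T true - T false) = 0], with [L] the sum of [l]
    over the indices where [b] holds, since the other indices sum to [- L]. *)
Lemma trace_obstruction (I : finType) (b : I -> bool) (x : I -> K)
    (A B : bool -> {poly rat}) (l : I -> int) :
  (forall c, [/\ A c \is monic, B c \is monic, size (A c) = (size (B c)).+1 &
    coprimep (A c) (B c)]) ->
  (size (B true) = size (B false) -> subcoef (A true) != subcoef (A false)) ->
  (forall i, l i != 0 -> (A (b i))^@.[x i] = q * (B (b i))^@.[x i]) ->
  \sum_i l i = 0 -> \sum_i (l i)%:~R * x i = 0 -> \sum_(i | b i) l i = 0.
Proof.
move=> ABP neqAB ABx sl slx.
pose T c := (q - ratr (subcoef (A c))) / (size (B c))%:R.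
have sB c : (0 < size (B c))%N by have [_ /monic_neq0] := ABP c; rewrite size_poly_gt0.
have /fin_all_exists[t tP] i : exists t : ratfun q, l i != 0 ->
    ntrace (val : {rmorphism ratfun q -> K}) (x i) t /\ val t = T (b i).
  have [l0|l0] := eqVneq (l i) 0; first by exists 0.
  have [mA mB sAB cop] := ABP (b i).
  by have [t xt vt] := ntrace_pencil q_transc cop (ABx i l0) mA mB sAB; exists t.
have := ntrace_sum (@ratfun_char0 _ q) (fun i li => (tP i li).1); rewrite slx.
move/(ntrace_uniq (@ratfun_char0 _ q))/(_ (ntrace0 _)).
move/(congr1 (val : {rmorphism ratfun q -> K})); rewrite rmorph_sum rmorph0.
have -> : \sum_i (val : {rmorphism ratfun q -> K}) ((l i)%:~R * t i) =
    \sum_i (l i)%:~R * T (b i).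
  apply: eq_bigr => i _; rewrite rmorphM rmorph_int.
  by have [->|/tP[_ <-] //] := eqVneq (l i) 0; rewrite !mul0r.
rewrite (bigID b) /=.
under eq_bigr => i bi do rewrite bi.
under [X in _ + X]eq_bigr => i /negPf bi do rewrite bi.
rewrite -!mulr_suml -!rmorph_sum.
have -> : \sum_(i | ~~ b i) l i = - \sum_(i | b i) l i.
  by move: sl; rewrite (bigID b) /= addrC => /eqP; rewrite addr_eq0 => /eqP.
rewrite rmorphN mulNr -mulrBr => /eqP; rewrite mulf_eq0 intr_eq0 => /orP[/eqP //|].
by rewrite subr_eq0 (negPf (transc_mean_neq _ _ _)).
Qed.
End TraceObstruction.

Lemma glued_pencil_root (K : numFieldType) (V1 V2 : finType) (u1 v1 : V1) (u2 v2 : V2)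
    (M1 : V1 -> V1 -> rat) (M2 : V2 -> V2 -> rat) e a1 m1 w1 a2 m2 w2
    (q l : K) (phi : glue_type V1 u2 v2 -> K) :
  u1 != v1 -> u2 != v2 ->
  pencil_data M1 u1 v1 e a1 m1 w1 -> pencil_data M2 u2 v2 e a2 m2 w2 ->
  (forall y, \sum_x phi x * glue_entry u1 v1 (fun a b => ratr (M1 a b))
     (fun a b => ratr (M2 a b)) q x y = l * phi y) ->
  phi (inl u1) + ratr e * phi (inl v1) != 0 ->
  (map_poly ratr (m2 * a1 + m1 * a2 - 'X * (m1 * m2))).[l] =
    q * (map_poly ratr (m1 * m2)).[l].
Proof.
move=> neq1 neq2 D1 D2 phiP phi0.
have [_ w1u w1v _] := D1; have [_ w2u w2v _] := D2.
have E1 := pencil_data_eval l D1; have E2 := pencil_data_eval l D2.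
have ev1 : (map_poly ratr (w1 v1)).[l] = ratr e * (map_poly ratr m1).[l].
  by rewrite w1v rmorphM /= map_polyC hornerM hornerC.
have ev2 : (map_poly ratr (w2 v2)).[l] = ratr e * (map_poly ratr m2).[l].
  by rewrite w2v rmorphM /= map_polyC hornerM hornerC.
have eu1 : (map_poly ratr (w1 u1)).[l] = (map_poly (ratr : rat -> K) m1).[l] by rewrite w1u.
have eu2 : (map_poly ratr (w2 u2)).[l] = (map_poly (ratr : rat -> K) m2).[l] by rewrite w2u.
have := glue_eigenvector neq1 neq2 eu1 ev1 eu2 ev2 E1 E2 phiP phi0.
by rewrite rmorphB rmorphD !rmorphM /= map_polyX !hornerE.
Qed.

Lemma eigenvalueB (F : fieldType) n (A : 'M[F]_n) (c x : F) :
  eigenvalue (A + c%:M) x -> eigenvalue A (x - c).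
Proof.
case/eigenvalueP => w wA w0; apply/eigenvalueP; exists w => //.
by apply/eqP; rewrite scalerBl -wA mulmxDr mul_mx_scalar addrK.
Qed.

Lemma horner_ratr_complex (R : realType) (p : {poly rat}) (x : R) :
  (map_poly (ratr : rat -> R[i]) p).[x%:C%C] = ((map_poly ratr p).[x])%:C%C.
Proof.
rewrite -horner_map -map_poly_comp; congr _.[_]; apply: eq_map_poly => r /=.
by rewrite fmorph_rat.
Qed.

Lemma transcendental_complex (R : realType) (x : R) : transcendental x ->
  ~ algebraicOver (ratr : rat -> R[i]) x%:C%C.
Proof.
move=> xtr [p p0 px]; apply: xtr; exists p => //.
by move: px; rewrite /root horner_ratr_complex fmorph_eq0.
Qed.

Lemma extend0_sym (R : nmodType) (V W : finType) (f : W -> option V) (M : 'M[R]_#|V|) :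
  M^T = M -> (extend0 f M)^T = extend0 f M.
Proof.
move=> MT; apply/matrixP => i j; rewrite !mxE.
case: (f _) => [a|]; case: (f _) => [b|] //.
by rewrite /entry -[in LHS]MT mxE.
Qed.

Lemma adjmx_sym (R : pzRingType) (G : sgraph) : (adjmx R G)^T = adjmx R G.
Proof. by apply/matrixP => i j; rewrite !mxE edge_sym. Qed.

Lemma Dmx_sym (R : pzRingType) (V : finType) (u v : V) : (Dmx R u v)^T = Dmx R u v.
Proof. by apply/matrixP => i j; rewrite !mxE eq_sym; case: eqP => [->|]. Qed.

Lemma root_char_adjmx (R : realType) (G : sgraph) (x : R) :
  eigenvalue (adjmx R G) x ->
  root (map_poly (ratr : rat -> R[i]) (char_poly (adjmx rat G))) x%:C%C.
Proof.
rewrite eigenvalue_root_char char_poly_ratr /root => /eqP x0.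
by rewrite horner_ratr_complex x0.
Qed.

Theorem theorem4p12 (R : realType) (G : sgraph) (u v : G) (k : nat)
    (pu pv : path_graph k)
    (huv : u <> v) (hcosp : cospectral R u v)
    (hk3 : (3 <= k)%N) (hkodd : odd k)
    (hpu : nat_of_ord pu = 0%N) (hpv : nat_of_ord pv = k.-1) :
  exists c : R,
    (forall x : R,
      ~ (eigenvalue (adjmx R (del [set u; v])) x /\
         eigenvalue (adjmx R (del [set pu; pv]) + c%:M) x)) /\
    (forall Q : R, transcendental Q ->
      PGST (mxglue u v pu pv (adjmx R G) (adjmx R (path_graph k) + c%:M)
              + Q *: Dmx R (inl u : glue_type G pu pv) (inl v))
           (inl u) (inl v)).
Proof.
have neq_uv : u != v by apply/eqP.
have neq_p : pu != pv by rewrite -val_eqE /= hpu hpv; case: (k) hk3 => [|[]].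
pose C := R[i]; pose e (b : bool) : rat := (-1) ^+ b.
have ee b : e b * e b = 1 by rewrite /e -expr2 exprAC sqrrN !expr1n.
have /fin_all_exists[aG /fin_all_exists[mG /fin_all_exists[wG GP]]] :=
  fun b => cospectral_pencil neq_uv hcosp (ee b).
(* [path_pencil] marks the even case by true, whereas here [b] true is the negative sign. *)
have eP b : e b = (-1) ^+ (~~ (~~ b)) by rewrite negbK.
have /fin_all_exists[aP /fin_all_exists[mP /fin_all_exists[wP PP]]] :=
  fun b => path_pencil hk3 hkodd hpu hpv (eP b).
(* One shift serves two purposes: the characteristic polynomials yield disjoint spectra, the factors
   [mG] and [mP] the coprimality required for gluing. *)
pose p1 := char_poly (adjmx rat (del [set u; v])) * (mG true * mG false).
pose p2 := char_poly (adjmx rat (del [set pu; pv])) * (mP true * mP false).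
have mG0 b : mG b \is monic by have [[]] := GP b.
have mP0 b : mP b \is monic by have [[[]]] := PP b.
have p10 : map_poly (ratr : rat -> C) p1 != 0.
  by rewrite map_poly_eq0 !mulf_neq0 ?monic_neq0 ?char_poly_monic.
have p20 : map_poly (ratr : rat -> C) p2 != 0.
  by rewrite map_poly_eq0 !mulf_neq0 ?monic_neq0 ?char_poly_monic.
(* The excluded value is the only [c] at which the subleading coefficients for the two signs would
   coincide. *)
have [c [cr cP]] := generic_shift (ratr (subcoef (aG false) - subcoef (aG true))) p10 p20.
exists c%:R; split.
  move=> x [x1 /eigenvalueB x2]; apply: (negP (cP x%:C%C _)).
    by rewrite rmorphM /= rootM; apply/orP; left; exact: (root_char_adjmx x1).
  have -> : x%:C%C - c%:R = (x - c%:R)%:C%C by rewrite rmorphB rmorph_nat.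
  by rewrite rmorphM /= rootM; apply/orP; left; exact: (root_char_adjmx x2).
move=> Q Qtr.
set N := _ + _ *: _.
pose M2 (x y : 'I_k) : rat := (path_edge x y)%:R + c%:R *+ (x == y).
pose s (p : {poly rat}) := p \Po ('X - (c%:R)%:P).
have P2 b : pencil_data M2 pu pv (e b) (s (aP b)) (s (mP b)) (fun i => s (wP b i)).
  by have [D _ _] := PP b; apply: pencil_data_shift.
have cop12 b : coprimep (mG b) (s (mP b)).
  rewrite -(coprimep_map (ratr : {rmorphism rat -> C})).
  apply: Pdiv.ClosedField.root_coprimep => z z1.
  have /cP : root (map_poly (ratr : rat -> C) p1) z.
    by rewrite !rmorphM /= !rootM; case: b z1 => ->; rewrite ?orbT.
  apply: contra; rewrite map_comp_poly horner_comp rmorphB /= map_polyX map_polyC /=.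
  rewrite rmorph_nat hornerD hornerN hornerX hornerC => z2.
  by rewrite !rmorphM /= !rootM /root; case: b {z1} z2 => ->; rewrite ?orbT.
pose A b := s (mP b) * aG b + mG b * s (aP b) - 'X * (mG b * s (mP b)).
pose B b := mG b * s (mP b).
have ABP b : [/\ A b \is monic, B b \is monic, size (A b) = (size (B b)).+1,
    coprimep (A b) (B b) & subcoef (A b) = subcoef (aG b) + subcoef (s (aP b))].
  have [[? ? ? ?] _ _ _] := GP b; have [[? ? ? ?] _ _ _] := P2 b.
  exact: glued_numer_spec.
have NE x y : (entry N x y)%:C%C = glue_entry u v
    (fun a b => ratr ((edge a b)%:R : rat)) (fun a b => ratr (M2 a b)) Q%:C%C x y :> C.
  pose M2R (x y : 'I_k) : R := (path_edge x y)%:R + c%:R *+ (x == y).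
  have D2 : adjmx R (path_graph k) + c%:R%:M = fmx M2R.
    apply/matrixP => i j; rewrite !mxE /M2R; congr (_ + _ *+ nat_of_bool _).
    by apply/esym; apply: (inj_eq enum_val_inj).
  rewrite /N D2 mxglue_entry; congr (glue_entry _ _ _ _ _ _ _).
    by apply/funext => a; apply/funext => b; rewrite !rmorph_nat.
  apply/funext => a; apply/funext => b.
  by rewrite /M2R /M2 !rmorphD !rmorphMn !rmorph1.
have PT : (adjmx R (path_graph k) + c%:R%:M)^T = adjmx R (path_graph k) + c%:R%:M.
  apply/matrixP => i j; rewrite [LHS]mxE [LHS]mxE [RHS]mxE; congr (_ + _).
    by rewrite -[in LHS]adjmx_sym mxE.
  by rewrite -[in LHS]tr_scalar_mx mxE.
have NT : N^T = N.
  rewrite /N /mxglue 2!linearD linearZ /= Dmx_sym.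
  by rewrite (extend0_sym _ (adjmx_sym R G)) (extend0_sym _ PT).
have [om [th [om0 om4 transE omP]]] := transfer_trig_sum (inl u) (inl v) NT.
apply: (PGST_trig_sum om0 om4 _ transE) => l l0 sl slx.
apply: (trace_obstruction (transcendental_complex Qtr)
  (x := fun j => (th j)%:C%C) (A := A) (B := B)) => //.
- by move=> b; have [] := ABP b.
(* The path contributes [k./2 + 1] eigenvalues to the even sign and [k./2] to the odd one, each
   moved by [c]; the two subleading coefficients thus differ by a nonconstant function of [c]. *)
- move=> _; have subA b : subcoef (A b) = subcoef (aG b) - c%:R *+ (k./2 + ~~ b).
    have [_ _ _ _ ->] := ABP b; have [[[ma _ sa _] _ _ _] sm ca] := PP b.
    by rewrite subcoef_shift // ca sa sm sub0r.
  rewrite !subA addn0 addn1 mulrSr; apply: contraNneq cr => E.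
  rewrite -(ratr_nat C c) fmorph_eq; apply/eqP.
  by move: E => /=; lra.
(* A nonzero weight provides an eigenvector not orthogonal to [e_u] plus or minus [e_v], so the
   eigenvalue is a root of the pencil of its sign. *)
- move=> i li; have omi : om i != 0 by apply: contraNneq li => /l0 ->.
  have [phi phi0 phiP] := omP i omi.
  apply: (glued_pencil_root neq_uv neq_p (GP i.1) (P2 i.1) (phi := phi)).
    by move=> y; rewrite -phiP; apply: eq_bigr => x _; rewrite NE.
  by rewrite /e rmorphXn rmorphN rmorph1.
have := congr1 (real_complex R) slx; rewrite rmorph0 rmorph_sum /= => slx'.
by apply: etrans slx'; apply: eq_bigr => i _; rewrite rmorphM /= rmorph_int.
Qed.
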